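(* Let $R$ be a nontrivial, unital, commutative ring that is Turing computable. Each of the following decision problems, whose input is a pair $\mathcal{A}$, $\mathcal{B}$ of semifree (noncommutative) differential graded algebras over $R$, is undecidable, i.e. no algorithm solves it for all inputs: (a) whether $\mathcal{A}$ and $\mathcal{B}$ are stable tame isomorphic; (b) whether $\mathcal{A}$ and $\mathcal{B}$ are quasi-isomorphic; (c) whether $\mathcal{A}$ and $\mathcal{B}$ are derived Morita equivalent.
   Context: Computability: $R$ is fixed and assumed Turing computable, meaning that its elements can be represented by finite data on which the ring operations can be carried out by a Turing machine (e.g. $\mathbb{Z}$, $\mathbb{Q}$, $\mathbb{Z}/n$; uncountable rings such as $\mathbb{R}$ or $\mathbb{C}$ are excluded). A semifree DGA is given as input by a finite list of generators, their integer degrees, and the differential of each generator as a noncommutative polynomial in the generators with coefficients in $R$. DGA: A differential graded algebra $\mathcal{A}=\bigoplus_{i\in\mathbb{Z}}\mathcal{A}_i$ over $R$ is a $\mathbb{Z}$-graded unital (associative, not necessarily commutative) $R$-algebra together with a differential $\partial:\mathcal{A}\to\mathcal{A}$ of degree $-1$ satisfying $\partial^2=0$ and the graded Leibniz rule $\partial(ab)=\partial(a)b+(-1)^{|a|}a\,\partial(b)$. It is semifree if, as a graded algebra, it is isomorphic to the free noncommutative $R$-algebra on finitely many homogeneous generators, i.e. to the tensor algebra $T(x_1,\dots,x_n)$ on the free $R$-module generated by $x_1,\dots,x_n$. Semifree DGAs are considered with such generators. Elementary automorphism: an automorphism of $T(x_1,\dots,x_n)$ that maps exactly one generator $x_i\mapsto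 \alpha x_i+P$, where $\alpha\in R^\times$ and $P$ is a homogeneous polynomial (of the same degree as $x_i$) exclusively in the remaining generators, and leaves all other generators fixed. Tame isomorphism: a tame isomorphism between $T(x_1,\dots,x_n)$ and $T(y_1,\dots,y_n)$ is the composition of some elementary automorphisms of $T(x_1,\dots,x_n)$ followed by the (graded) isomorphism sending $x_i\mapsto y_i$ for all $i$. Two semifree DGAs are tame isomorphic if they are related by a tame isomorphism of the underlying tensor algebras that commutes with the differentials. Stabilization: a stabilization of a semifree DGA is obtained by adjoining two free generators $e$ and $f$ of degrees $k+1$ and $k$ (for some $k\in\mathbb{Z}$) with $\partial(e)=f$ and $\partial(f)=0$. Two semifree DGAs are stable tame isomorphic if they become tame isomorphic after applying finitely many stabilizations to each. Quasi-isomorphism: a quasi-isomorphism between DGAs is a DG homomorphism inducing an isomorphism on homology; two DGAs are quasi-isomorphic if they are related by a zigzag of quasi-isomorphisms. Derived Morita equivalence: $\mathcal{D}(\mathcal{A})$ denotes the derived category of left DG modules over $\mathcal{A}$. Two semifree DGAs $\mathcal{A}$ and $\mathcal{B}$ are derived Morita equivalent if $\mathcal{D}(\mathcal{A})$ and $\mathcal{D}(\mathcal{B})$ are equivalent as triangulated categories. *)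

(* Defs.v *)
From HB Require Import structures.
From mathcomp Require Import all_boot all_order all_algebra finmap.
From mathcomp Require Import monalg.

Set Implicit Arguments.
Unset Strict Implicit.
Unset Printing Implicit Defensive.

Import Order.TTheory GRing.Theory Num.Theory.
Local Open Scope ring_scope.

(* A tape cell holds a bit (input alphabet), an auxiliary symbol, or [None],
   the blank. The machine halts when [tm_trans] returns [None]. *)
Inductive direction := MoveLeft | Stay | MoveRight.

Record turing_machine := TuringMachine {
  tm_state : finType;
  tm_aux : finType;
  tm_start : tm_state;
  tm_trans : tm_state -> option (bool + tm_aux) ->
             option (tm_state * option (bool + tm_aux) * direction);
  tm_accepting : pred tm_state }.

Section Turing.
Variable M : turing_machine.

Definition tm_cell := option (bool + tm_aux M).

(* State, cells left of the head (nearest first), and cells from the head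
   rightwards; all the cells not listed are blank. *)
Definition tm_config := (tm_state M * seq tm_cell * seq tm_cell)%type.

Definition tm_step (c : tm_config) : option tm_config :=
  let: (q, l, r) := c in
  if tm_trans q (head None r) is Some (q', b, dir) then
    Some (match dir with
          | MoveLeft => (q', behead l, [:: head None l, b & behead r])
          | Stay => (q', l, b :: behead r)
          | MoveRight => (q', b :: l, behead r)
          end)
  else None.

Inductive tm_ends : tm_config -> tm_config -> Prop :=
| tm_ends_now c : tm_step c = None -> tm_ends c c
| tm_ends_later c c' f : tm_step c = Some c' -> tm_ends c' f -> tm_ends c f.

Definition tm_bits (w : seq bool) : seq tm_cell := [seq Some (inl b) | b <- w].

Definition tm_init (w : seq bool) : tm_config :=
  (tm_start M, [::], tm_bits w).

Definition tm_accepts (w : seq bool) : Prop :=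
  exists q l r, tm_ends (tm_init w) (q, l, r) /\ tm_accepting q.

Definition tm_rejects (w : seq bool) : Prop :=
  exists q l r, tm_ends (tm_init w) (q, l, r) /\ ~~ tm_accepting q.

(* The output is read from the final head position rightwards. *)
Definition tm_computes (w v : seq bool) : Prop :=
  exists q l n, tm_ends (tm_init w) (q, l, tm_bits v ++ nseq n None).

End Turing.

(* The encodings below are self-delimiting. *)
Definition enc_nat (n : nat) : seq bool := rcons (nseq n true) false.

Definition enc_int (z : int) : seq bool :=
  match z with
  | Posz n => false :: enc_nat n
  | Negz n => true :: enc_nat n
  end.

Definition enc_bit (b : bool) : seq bool := [:: b].

Definition enc_pair (S T : Type) (f : S -> seq bool) (g : T -> seq bool)
  (x : S * T) : seq bool := f x.1 ++ g x.2.

Definition enc_seq (T : Type) (f : T -> seq bool) (s : seq T) : seq bool :=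
  flatten [seq true :: f x | x <- s] ++ [:: false].

Definition enc_word : seq bool -> seq bool := enc_seq enc_bit.

(* [rep w x]: the word [w] is a name of [x]. An element may have several
   names. As R is the image of a set of words, it is countable. *)
Record turing_computable (R : comNzRingType) (rep : seq bool -> R -> Prop) :
    Prop := TuringComputable {
  rep_total : forall x, exists w, rep w x;
  rep_functional : forall w x y, rep w x -> rep w y -> x = y;
  rep_add : exists M, forall v w x y, rep v x -> rep w y ->
    exists2 u, tm_computes M (enc_pair enc_word enc_word (v, w)) u
             & rep u (x + y);
  rep_opp : exists M, forall v x, rep v x ->
    exists2 u, tm_computes M (enc_word v) u & rep u (- x);
  rep_mul : exists M, forall v w x y, rep v x -> rep w y ->
    exists2 u, tm_computes M (enc_pair enc_word enc_word (v, w)) u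
             & rep u (x * y) }.

Definition ksign (V : zmodType) (i : int) (x : V) : V := x *~ ((-1) ^ i).

Record complex (R : comNzRingType) := Complex {
  cpx_at :> int -> lmodType R;
  cpx_d : forall i, cpx_at i -> cpx_at (i - 1);
  cpx_dL : forall i, linear (@cpx_d i);
  cpx_dd : forall i (x : cpx_at i), cpx_d (cpx_d x) = 0 }.
Arguments cpx_d {R} _ {i} _.

Record cpx_map (R : comNzRingType) (C D : complex R) := CpxMap {
  cpx_fun :> forall i, C i -> D i;
  cpx_funL : forall i, linear (@cpx_fun i);
  cpx_fun_d : forall i (x : C i),
    cpx_fun (cpx_d C x) = cpx_d D (cpx_fun x) }.
Arguments cpx_fun {R C D} _ {i} _.

(* Two cycles of degree i - 1 define the same homology class. *)
Definition homologous (R : comNzRingType) (C : complex R) (i : int)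
  (x y : C (i - 1)) : Prop := exists z : C i, x - y = cpx_d C z.

(* The map induced on homology is injective and surjective; every integer
   degree is of the form i - 1. *)
Definition quasi_iso (R : comNzRingType) (C D : complex R)
    (f : cpx_map C D) : Prop :=
  forall i,
    (forall x y : C (i - 1), cpx_d C x = 0 -> cpx_d C y = 0 ->
       homologous (cpx_fun f x) (cpx_fun f y) -> homologous x y) /\
    (forall y : D (i - 1), cpx_d D y = 0 ->
       exists2 x : C (i - 1), cpx_d C x = 0 & homologous (cpx_fun f x) y).

(* A = (+)_i A_i is given by its homogeneous components. The product
   A_i x A_j -> A_k takes a proof of i + j = k, so that the laws can be stated
   without casts between equal degrees. *)
Record dga (R : comNzRingType) := Dga {
  dga_cpx :> complex R;
  dga_one : dga_cpx 0;
  dga_mul : forall i j k : int, i + j = k ->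
    dga_cpx i -> dga_cpx j -> dga_cpx k;
  dga_mulLl : forall (i j k : int) (e : i + j = k) (b : dga_cpx j),
    linear ((dga_mul e)^~ b);
  dga_mulLr : forall (i j k : int) (e : i + j = k) (a : dga_cpx i),
    linear (dga_mul e a);
  dga_mulA : forall (i j k ij jk l : int) (e1 : j + k = jk) (e2 : i + jk = l)
      (e3 : i + j = ij) (e4 : ij + k = l)
      (a : dga_cpx i) (b : dga_cpx j) (c : dga_cpx k),
    dga_mul e2 a (dga_mul e1 b c) = dga_mul e4 (dga_mul e3 a b) c;
  dga_mul1a : forall (i : int) (e : 0 + i = i) (a : dga_cpx i),
    dga_mul e dga_one a = a;
  dga_mula1 : forall (i : int) (e : i + 0 = i) (a : dga_cpx i),
    dga_mul e a dga_one = a;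
  dga_leibniz : forall (i j k : int) (e : i + j = k) (e1 : i - 1 + j = k - 1)
      (e2 : i + (j - 1) = k - 1) (a : dga_cpx i) (b : dga_cpx j),
    cpx_d dga_cpx (dga_mul e a b)
      = dga_mul e1 (cpx_d dga_cpx a) b
        + ksign i (dga_mul e2 a (cpx_d dga_cpx b)) }.
Arguments dga_one {R} _.
Arguments dga_mul {R} _ {i j k} _ _ _.

Record dga_hom (R : comNzRingType) (A B : dga R) := DgaHom {
  dga_fun :> cpx_map A B;
  dga_fun1 : cpx_fun dga_fun (dga_one A) = dga_one B;
  dga_funM : forall (i j k : int) (e : i + j = k) (a : A i) (b : A j),
    cpx_fun dga_fun (dga_mul A e a b)
      = dga_mul B e (cpx_fun dga_fun a) (cpx_fun dga_fun b) }.

Inductive quasi_isomorphic (R : comNzRingType) (A : dga R) : dga R -> Prop :=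
| qi_refl : quasi_isomorphic A A
| qi_forward B C (f : dga_hom B C) :
    quasi_isomorphic A B -> quasi_iso f -> quasi_isomorphic A C
| qi_backward B C (f : dga_hom C B) :
    quasi_isomorphic A B -> quasi_iso f -> quasi_isomorphic A C.

(* The tensor algebra on a finite set of generators: the algebra of the free
   monoid of words in the generators. *)
Definition tensor_alg (R : comNzRingType) (G : finType) : lalgType R :=
  {malg R[{fmonom G}]}.

Section TensorAlgebra.
Variables (R : comNzRingType) (G : finType).

Definition gvar (x : G) : tensor_alg R G := << fmu x >>.

Variable deg : G -> int.

Definition word_degree (m : {fmonom G}) : int :=
  \sum_(x <- (m : seq G)) deg x.

Definition homog (i : int) : {pred tensor_alg R G} :=
  fun p => all (fun m => word_degree m == i) (msupp p).

End TensorAlgebra.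
Arguments homog R {G} deg i.

(* The generators form a finite set that carries no ordering. *)
Record semifree (R : comNzRingType) := Semifree {
  sf_gen : finType;
  sf_deg : sf_gen -> int;
  sf_d : tensor_alg R sf_gen -> tensor_alg R sf_gen;
  sf_dL : linear sf_d;
  sf_d_homog : forall i p,
    p \in homog R sf_deg i -> sf_d p \in homog R sf_deg (i - 1);
  sf_dd : forall p, sf_d (sf_d p) = 0;
  sf_leibniz : forall i p q, p \in homog R sf_deg i ->
    sf_d (p * q) = sf_d p * q + ksign i (p * sf_d q) }.
Arguments sf_deg {R} _ _.
Arguments sf_d {R} _ _.

Notation sf_alg S := (tensor_alg _ (sf_gen S)).

Section HomogeneousComponent.
Variables (R : comNzRingType) (G : finType) (deg : G -> int).

Local Notation T := (tensor_alg R G).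

Lemma homogP i (p : T) :
  reflect (forall m, p@_m != 0 -> word_degree deg m = i) (p \in homog R deg i).
Proof.
apply: (iffP allP) => [H m|H m].
  by rewrite mcoeff_neq0 => /H /eqP.
by rewrite -mcoeff_neq0 => /H ->.
Qed.

Fact homog_submod_closed i : submod_closed (homog R deg i).
Proof.
split=> [|c p q /homogP Hp /homogP Hq].
  by apply/homogP => m; rewrite mcoeff0 eqxx.
apply/homogP => m; rewrite mcoeffD mcoeffZ => nz.
have [pm0|/Hp//] := eqVneq p@_m 0.
by move: nz; rewrite pm0 mulr0 add0r; apply: Hq.
Qed.

HB.instance Definition _ i :=
  GRing.isSubmodClosed.Build R T (homog R deg i) (homog_submod_closed i).

Record hcomp (i : int) := HComp { hval :> T; hvalP : hval \in homog R deg i }.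

HB.instance Definition _ i := [isSub for @hval i].
HB.instance Definition _ i := [Choice of hcomp i by <:].
HB.instance Definition _ i := [SubChoice_isSubLmodule of hcomp i by <:].

End HomogeneousComponent.

Section DgaOfSemifree.
Variables (R : comNzRingType) (S : semifree R).

Local Notation H := (hcomp R (sf_deg S)).

Definition sf_hcomp_d i (p : H i) : H (i - 1) :=
  HComp (sf_d_homog (hvalP p)).

Fact sf_hcomp_dL i : linear (@sf_hcomp_d i).
Proof. by move=> c p q; apply: val_inj; rewrite /= sf_dL. Qed.

Fact sf_hcomp_dd i (p : H i) : sf_hcomp_d (sf_hcomp_d p) = 0.
Proof. by apply: val_inj; rewrite /= sf_dd. Qed.

Definition sf_complex : complex R := Complex sf_hcomp_dL sf_hcomp_dd.

Fact homog1 : 1 \in homog R (sf_deg S) 0.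
Proof.
apply/homogP => m; rewrite mcoeff1; have [-> _|_] := eqVneq m mone.
  by rewrite /word_degree fm1 big_nil.
by rewrite eqxx.
Qed.

Fact homogM i j k (e : i + j = k) (p q : sf_alg S) :
  p \in homog R (sf_deg S) i -> q \in homog R (sf_deg S) j ->
  p * q \in homog R (sf_deg S) k.
Proof.
move=> /allP Hp /allP Hq; apply/allP => m.
move=> /msuppM_le [m1 [m2 [/Hp /eqP d1 /Hq /eqP d2 ->]]].
by rewrite /word_degree fmM big_cat /= -/(word_degree _ m1) d1
  -/(word_degree _ m2) d2 e.
Qed.

Definition sf_hcomp_mul i j k (e : i + j = k) (p : H i) (q : H j) : H k :=
  HComp (homogM e (hvalP p) (hvalP q)).

Fact hval_ksign i j (p : H i) : hval (ksign j p) = ksign j (hval p).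
Proof. by rewrite /ksign -[hval _]/(\val _) raddfMz. Qed.

Fact tensor_scalerAr (c : R) (p q : sf_alg S) : p * (c *: q) = c *: (p * q).
Proof.
apply/malgP => m; rewrite mcoeffZ [in RHS]mcoeffMl.
rewrite (mcoeffMlw _ (fsubset_refl _) (msuppZ_le c q)) mulr_sumr.
apply: eq_bigr => k1 _; rewrite mulr_sumr; apply: eq_bigr => k2 _.
by rewrite mcoeffZ mulrCA mulrnAr.
Qed.

Definition dga_of_semifree : dga R.
Proof.
apply: (@Dga R sf_complex (HComp homog1) sf_hcomp_mul).
- by move=> i j k e b c p q; apply: val_inj; rewrite /= mulrDl scalerAl.
- move=> i j k e a c p q; apply: val_inj.
  by rewrite /= mulrDr tensor_scalerAr.
- by move=> *; apply: val_inj; rewrite /= mulrA.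
- by move=> *; apply: val_inj; rewrite /= mul1r.
- by move=> *; apply: val_inj; rewrite /= mulr1.
- move=> i j k e e1 e2 p q; apply: val_inj.
  by rewrite /= (sf_leibniz _ (hvalP p)) hval_ksign.
Defined.

End DgaOfSemifree.

Section Tame.
Variable R : comNzRingType.

(* An algebra endomorphism of this form is automatically bijective. *)
Definition elementary (S : semifree R)
    (phi : {lrmorphism sf_alg S -> sf_alg S}) : Prop :=
  exists (x : sf_gen S) (a : R) (p : sf_alg S),
    [/\ exists b, a * b = 1,
        p \in homog R (sf_deg S) (sf_deg S x),
        forall m, m \in msupp p -> x \notin (m : seq (sf_gen S)),
        phi (gvar R x) = a *: gvar R x + p
      & forall y, y != x -> phi (gvar R y) = gvar R y].

Inductive tame_automorphism (S : semifree R) :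
    (sf_alg S -> sf_alg S) -> Prop :=
| tame_id : tame_automorphism id
| tame_comp (phi : {lrmorphism sf_alg S -> sf_alg S}) psi :
    elementary phi -> tame_automorphism psi -> tame_automorphism (phi \o psi).

(* Matching the generators of S with those of S' by a bijection amounts to
   numbering both sets of generators. *)
Definition tame_isomorphic (S S' : semifree R) : Prop :=
  exists (f : sf_alg S -> sf_alg S) (s : sf_gen S -> sf_gen S')
         (r : {lrmorphism sf_alg S -> sf_alg S'}),
    [/\ tame_automorphism f,
        bijective s /\ forall x, sf_deg S' (s x) = sf_deg S x,
        forall x, r (gvar R x) = gvar R (s x)
      & forall p, r (f (sf_d S p)) = sf_d S' (r (f p))].

(* Up to renaming, the generators of S' are those of S together with
   e = g (inr true) and f = g (inr false). *)
Definition stabilization (S S' : semifree R) : Prop :=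
  exists (k : int) (g : sf_gen S + bool -> sf_gen S')
         (j : {lrmorphism sf_alg S -> sf_alg S'}),
    [/\ bijective g,
        forall x, j (gvar R x) = gvar R (g (inl x)),
        forall x, sf_deg S' (g (inl x)) = sf_deg S x
          /\ sf_d S' (gvar R (g (inl x))) = j (sf_d S (gvar R x)),
        sf_deg S' (g (inr true)) = k + 1 /\ sf_deg S' (g (inr false)) = k
      & sf_d S' (gvar R (g (inr true))) = gvar R (g (inr false))
        /\ sf_d S' (gvar R (g (inr false))) = 0].

Inductive iterated_stabilization (S : semifree R) : semifree R -> Prop :=
| stab_none : iterated_stabilization S S
| stab_more S' S'' : iterated_stabilization S S' -> stabilization S' S'' ->
    iterated_stabilization S S''.

Definition stable_tame_isomorphic (S1 S2 : semifree R) : Prop :=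
  exists S1' S2', [/\ iterated_stabilization S1 S1',
    iterated_stabilization S2 S2' & tame_isomorphic S1' S2'].

End Tame.

(* Morphisms are taken modulo [meq]. *)
Record category := Category {
  obj :> Type;
  mor : obj -> obj -> Type;
  meq : forall X Y, mor X Y -> mor X Y -> Prop;
  idm : forall X, mor X X;
  mcomp : forall X Y Z, mor Y Z -> mor X Y -> mor X Z;
  meq_refl : forall X Y (f : mor X Y), meq f f;
  meq_sym : forall X Y (f g : mor X Y), meq f g -> meq g f;
  meq_trans : forall X Y (f g h : mor X Y), meq f g -> meq g h -> meq f h;
  meq_comp : forall X Y Z (g g' : mor Y Z) (f f' : mor X Y),
    meq g g' -> meq f f' -> meq (mcomp g f) (mcomp g' f');
  mcomp1m : forall X Y (f : mor X Y), meq (mcomp (idm Y) f) f;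
  mcompm1 : forall X Y (f : mor X Y), meq (mcomp f (idm X)) f;
  mcompA : forall X Y Z W (h : mor Z W) (g : mor Y Z) (f : mor X Y),
    meq (mcomp h (mcomp g f)) (mcomp (mcomp h g) f) }.
Arguments mor {_} _ _.
Arguments meq {_ _ _} _ _.
Arguments idm {_} _.
Arguments mcomp {_ _ _ _} _ _.

Definition inverse_mor (C : category) (X Y : C) (f : mor X Y) (g : mor Y X) :=
  meq (mcomp g f) (idm X) /\ meq (mcomp f g) (idm Y).

Definition is_iso (C : category) (X Y : C) (f : mor X Y) : Prop :=
  exists g, inverse_mor f g.

Record functor (C D : category) := Functor {
  fobj :> C -> D;
  fmap : forall X Y, mor X Y -> mor (fobj X) (fobj Y);
  fmap_eq : forall X Y (f g : mor X Y), meq f g -> meq (fmap f) (fmap g);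
  fmap_id : forall X, meq (fmap (idm X)) (idm (fobj X));
  fmap_comp : forall X Y Z (g : mor Y Z) (f : mor X Y),
    meq (fmap (mcomp g f)) (mcomp (fmap g) (fmap f)) }.
Arguments fmap {C D} _ {X Y} _.

Definition id_functor (C : category) : functor C C :=
  @Functor C C id (fun _ _ => id) (fun _ _ _ _ => id)
    (fun _ => meq_refl _) (fun _ _ _ _ _ => meq_refl _).

Section FunctorComp.
Variables (C D E : category) (G : functor D E) (F : functor C D).

Fact comp_functor_id X : meq (fmap G (fmap F (idm X))) (idm (G (F X))).
Proof. exact: meq_trans (fmap_eq G (fmap_id F X)) (fmap_id G _). Qed.

Fact comp_functor_comp X Y Z (g : mor Y Z) (f : mor X Y) :
  meq (fmap G (fmap F (mcomp g f)))
      (mcomp (fmap G (fmap F g)) (fmap G (fmap F f))).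
Proof. exact: meq_trans (fmap_eq G (fmap_comp F g f)) (fmap_comp G _ _). Qed.

Definition comp_functor : functor C E :=
  @Functor C E (fun X => G (F X)) (fun _ _ f => fmap G (fmap F f))
    (fun _ _ _ _ e => fmap_eq G (fmap_eq F e))
    comp_functor_id comp_functor_comp.

End FunctorComp.

Record natural_iso (C D : category) (F G : functor C D) := NaturalIso {
  nat_mor :> forall X, mor (F X) (G X);
  nat_inv : forall X, mor (G X) (F X);
  nat_inverse : forall X, inverse_mor (nat_mor X) (nat_inv X);
  nat_square : forall X Y (f : mor X Y),
    meq (mcomp (nat_mor Y) (fmap F f)) (mcomp (fmap G f) (nat_mor X)) }.

(* The data of a triangulated category: the addition of morphisms (as the
   graph of a binary operation), the suspension and the distinguished
   triangles. *)
Record tricat := Tricat {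
  tri_cat :> category;
  tri_add : forall X Y : tri_cat, mor X Y -> mor X Y -> mor X Y -> Prop;
  tri_susp : functor tri_cat tri_cat;
  tri_dist : forall X Y Z : tri_cat,
    mor X Y -> mor Y Z -> mor Z (tri_susp X) -> Prop }.
Arguments tri_add {_ _ _} _ _ _.
Arguments tri_susp {_}.
Arguments tri_dist {_ _ _ _} _ _ _.

Record tri_equivalence (C D : tricat) := TriEquivalence {
  te_fun :> functor C D;
  te_inv : functor D C;
  te_unit : natural_iso (comp_functor te_inv te_fun) (id_functor C);
  te_counit : natural_iso (comp_functor te_fun te_inv) (id_functor D);
  te_add : forall (X Y : C) (f g h : mor X Y),
    tri_add f g h -> tri_add (fmap te_fun f) (fmap te_fun g) (fmap te_fun h);
  te_susp : natural_iso (comp_functor te_fun tri_susp)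
                        (comp_functor tri_susp te_fun);
  te_dist : forall (X Y Z : C) (u : mor X Y) (v : mor Y Z)
      (w : mor Z (tri_susp X)),
    tri_dist u v w ->
    tri_dist (fmap te_fun u) (fmap te_fun v)
             (mcomp (te_susp X) (fmap te_fun w)) }.

Record dgmod (R : comNzRingType) (A : dga R) := Dgmod {
  dgm_cpx :> complex R;
  dgm_act : forall i j k : int, i + j = k ->
    A i -> dgm_cpx j -> dgm_cpx k;
  dgm_actLl : forall (i j k : int) (e : i + j = k) (x : dgm_cpx j),
    linear ((dgm_act e)^~ x);
  dgm_actLr : forall (i j k : int) (e : i + j = k) (a : A i),
    linear (dgm_act e a);
  dgm_actA : forall (i j k ij jk l : int) (e1 : j + k = jk) (e2 : i + jk = l)
      (e3 : i + j = ij) (e4 : ij + k = l)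
      (a : A i) (b : A j) (x : dgm_cpx k),
    dgm_act e2 a (dgm_act e1 b x) = dgm_act e4 (dga_mul A e3 a b) x;
  dgm_act1 : forall (i : int) (e : 0 + i = i) (x : dgm_cpx i),
    dgm_act e (dga_one A) x = x;
  dgm_leibniz : forall (i j k : int) (e : i + j = k) (e1 : i - 1 + j = k - 1)
      (e2 : i + (j - 1) = k - 1) (a : A i) (x : dgm_cpx j),
    cpx_d dgm_cpx (dgm_act e a x)
      = dgm_act e1 (cpx_d A a) x
        + ksign i (dgm_act e2 a (cpx_d dgm_cpx x)) }.
Arguments dgm_act {R A} _ {i j k} _ _ _.

Record dgm_hom (R : comNzRingType) (A : dga R) (M N : dgmod A) := DgmHom {
  dgm_fun :> cpx_map M N;
  dgm_fun_act : forall (i j k : int) (e : i + j = k) (a : A i) (x : M j),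
    cpx_fun dgm_fun (dgm_act M e a x)
      = dgm_act N e a (cpx_fun dgm_fun x) }.

Section KoszulSign.
Variable R : comNzRingType.

Fact ksignD (V : zmodType) i (x y : V) :
  ksign i (x + y) = ksign i x + ksign i y.
Proof. exact: mulrzDl. Qed.

Fact ksignN (V : zmodType) i (x : V) : ksign i (- x) = - ksign i x.
Proof. exact: mulNrz. Qed.

Fact ksignM (V : zmodType) i j (x : V) : ksign i (ksign j x) = ksign (i + j) x.
Proof. by rewrite /ksign exprzDr ?unitrN1 // mulrC mulrzA. Qed.

Fact ksign_pred (V : zmodType) i (x : V) : ksign (i - 1) x = - ksign i x.
Proof. by rewrite /ksign exprzDr ?unitrN1 // exprN1 mulrN1 mulrNz. Qed.

Fact ksignZ (V : lmodType R) i (c : R) (x : V) :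
  ksign i (c *: x) = c *: ksign i x.
Proof. exact: scalerMzr. Qed.

Fact ksign_pair (U V : lmodType R) i (x : U) (y : V) :
  ksign i (x, y) = (ksign i x, ksign i y).
Proof. by rewrite /ksign -!scaler_int. Qed.

Fact lin0 (U V : lmodType R) (f : U -> V) : linear f -> f 0 = 0.
Proof.
by move=> fL; have := fL (-1) 0 0; rewrite scaler0 addr0 scaleN1r addNr.
Qed.

Fact linZ (U V : lmodType R) (f : U -> V) c x :
  linear f -> f (c *: x) = c *: f x.
Proof. by move=> fL; have := fL c x 0; rewrite (lin0 fL) !addr0. Qed.

Fact linD (U V : lmodType R) (f : U -> V) x y :
  linear f -> f (x + y) = f x + f y.
Proof. by move=> fL; have := fL 1 x y; rewrite !scale1r. Qed.

Fact linN (U V : lmodType R) (f : U -> V) x : linear f -> f (- x) = - f x.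
Proof. by move=> fL; rewrite -scaleN1r linZ // scaleN1r. Qed.

Fact lin_ksign (U V : lmodType R) (f : U -> V) i x :
  linear f -> f (ksign i x) = ksign i (f x).
Proof. by move=> fL; rewrite /ksign -!scaler_int linZ. Qed.

End KoszulSign.

Section DGModules.
Variables (R : comNzRingType) (A : dga R).
Implicit Types M N P : dgmod A.

Fact idx_pred (i j k : int) : i + j = k -> i + (j - 1) = k - 1.
Proof. by move=> <-; rewrite addrA. Qed.

Definition cpx_id (C : complex R) : cpx_map C C.
Proof. by refine (@CpxMap _ C C (fun _ => id) _ _). Defined.

Definition dgm_id M : dgm_hom M M.
Proof. by refine (@DgmHom _ _ M M (cpx_id M) _). Defined.

Definition cpx_comp (C D E : complex R) (g : cpx_map D E) (f : cpx_map C D) :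
  cpx_map C E.
Proof.
refine (@CpxMap _ C E (fun _ x => cpx_fun g (cpx_fun f x)) _ _).
- by move=> i c x y; rewrite (cpx_funL f) (cpx_funL g).
- by move=> i x; rewrite !cpx_fun_d.
Defined.

Definition dgm_comp M N P (g : dgm_hom N P) (f : dgm_hom M N) : dgm_hom M P.
Proof.
refine (@DgmHom _ _ M P (cpx_comp g f) _) => i j k e a x /=.
by rewrite !dgm_fun_act.
Defined.

Definition cpx_sum (C D : complex R) : complex R.
Proof.
refine (@Complex R (fun i => (C i * D i)%type)
  (fun i x => (cpx_d C x.1, cpx_d D x.2)) _ _).
- by move=> i c x y; rewrite /= !cpx_dL.
- by move=> i x; rewrite /= !cpx_dd.
Defined.

Definition dgm_sum M N : dgmod A.
Proof.
refine (@Dgmod _ A (cpx_sum M N)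
  (fun i j k e a x => (dgm_act M e a x.1, dgm_act N e a x.2)) _ _ _ _ _) => /=.
- by move=> i j k e x c a b /=; rewrite !dgm_actLl.
- by move=> i j k e a c x y /=; rewrite !dgm_actLr.
- by move=> i j k ij jk l e1 e2 e3 e4 a b x; rewrite !(dgm_actA _ _ e3 e4).
- by move=> i e [x y]; rewrite !dgm_act1.
- move=> i j k e e1 e2 a x.
  by rewrite !(dgm_leibniz e e1 e2) ksign_pair.
Defined.

Definition cpx_inl (C D : complex R) : cpx_map C (cpx_sum C D).
Proof.
refine (@CpxMap _ C (cpx_sum C D) (fun _ x => (x, 0)) _ _).
- by move=> i c x y; congr (_, _); rewrite /= scaler0 addr0.
- by move=> i x; congr (_, _); rewrite /= (lin0 (@cpx_dL _ _ _)).
Defined.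

Definition cpx_inr (C D : complex R) : cpx_map D (cpx_sum C D).
Proof.
refine (@CpxMap _ D (cpx_sum C D) (fun _ x => (0, x)) _ _).
- by move=> i c x y; congr (_, _); rewrite /= scaler0 addr0.
- by move=> i x; congr (_, _); rewrite /= (lin0 (@cpx_dL _ _ _)).
Defined.

Definition cpx_diag (C : complex R) : cpx_map C (cpx_sum C C).
Proof. by refine (@CpxMap _ C (cpx_sum C C) (fun _ x => (x, x)) _ _). Defined.

Definition dgm_inl M N : dgm_hom M (dgm_sum M N).
Proof.
refine (@DgmHom _ _ M (dgm_sum M N) (cpx_inl M N) _) => i j k e a x.
by congr (_, _); rewrite /= (lin0 (dgm_actLr _ _)).
Defined.

Definition dgm_inr M N : dgm_hom N (dgm_sum M N).
Proof.
refine (@DgmHom _ _ N (dgm_sum M N) (cpx_inr M N) _) => i j k e a x.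
by congr (_, _); rewrite /= (lin0 (dgm_actLr _ _)).
Defined.

Definition dgm_diag M : dgm_hom M (dgm_sum M M).
Proof. by refine (@DgmHom _ _ M (dgm_sum M M) (cpx_diag M) _). Defined.

Definition cpx_shift (C : complex R) : complex R.
Proof.
refine (@Complex R (fun i => C (i - 1)) (fun i x => - cpx_d C x) _ _).
- by move=> i c x y; rewrite /= cpx_dL opprD scalerN.
- by move=> i x; rewrite /= (linN _ (@cpx_dL _ _ _)) cpx_dd !oppr0.
Defined.

(* (M[1])_i = M_(i-1), with differential - d and with a of degree i acting as
   (-1)^i a, as is required by the Leibniz rule for left modules. *)
Definition dgm_shift M : dgmod A.
Proof.
refine (@Dgmod _ A (cpx_shift M)
  (fun i j k e a x => ksign i (dgm_act M (idx_pred e) a x)) _ _ _ _ _) => /=.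
- by move=> i j k e x c a b /=; rewrite dgm_actLl ksignD ksignZ.
- by move=> i j k e a c x y /=; rewrite dgm_actLr ksignD ksignZ.
- move=> i j k ij jk l e1 e2 e3 e4 a b x.
  rewrite (lin_ksign _ _ (@dgm_actLr _ _ _ _ _ _ _ _)) ksignM e3.
  by rewrite (dgm_actA _ _ e3 (idx_pred e4)).
- by move=> i e x; rewrite dgm_act1.
- move=> i j k e e1 e2 a x.
  rewrite (lin_ksign _ _ (@cpx_dL _ _ _)).
  rewrite (dgm_leibniz _ (idx_pred e1) (idx_pred e2)) ksignD opprD ksign_pred.
  by rewrite (linN _ (@dgm_actLr _ _ _ _ _ _ _ _)) !ksignN.
Defined.

Definition cpx_map_shift (C D : complex R) (f : cpx_map C D) :
  cpx_map (cpx_shift C) (cpx_shift D).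
Proof.
refine (@CpxMap _ (cpx_shift C) (cpx_shift D) (fun i x => cpx_fun f x) _ _).
- by move=> i c x y; apply: (cpx_funL f).
- by move=> i x; rewrite /= (linN _ (@cpx_funL _ _ _ _ _)) cpx_fun_d.
Defined.

Definition dgm_hom_shift M N (f : dgm_hom M N) :
  dgm_hom (dgm_shift M) (dgm_shift N).
Proof.
refine (@DgmHom _ _ (dgm_shift M) (dgm_shift N) (cpx_map_shift f) _) => /=.
move=> i j k e a x.
by rewrite (lin_ksign _ _ (@cpx_funL _ _ _ _ _)) dgm_fun_act.
Defined.

Fact quasi_iso_shift (C D : complex R) (f : cpx_map C D) :
  quasi_iso f -> quasi_iso (cpx_map_shift f).
Proof.
have dN (E : complex R) j (x : E j) : - cpx_d E x = cpx_d E (- x).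
  by rewrite (linN _ (@cpx_dL _ _ _)).
have d0 (E : complex R) j (x : E j) : (- cpx_d E x = 0) <-> (cpx_d E x = 0).
  by split=> [/eqP|->]; rewrite ?oppr0 // oppr_eq0 => /eqP.
have hS (E : complex R) i (x y : cpx_shift E (i - 1)) :
    homologous x y <-> @homologous _ E (i - 1) x y.
  split=> -[z ez]; exists (- z); first by rewrite -dN; apply: ez.
  by rewrite /= dN opprK; apply: ez.
move=> fq i; have [fi fs] := fq (i - 1); split.
- move=> x y dx dy h; apply: (proj2 (hS C i x y)); apply: fi.
  + exact: (proj1 (d0 C (i - 1 - 1) x) dx).
  + exact: (proj1 (d0 C (i - 1 - 1) y) dy).
  + exact: (proj1 (hS D i _ _) h).
- move=> y dy; have [x dx h] := fs y (proj1 (d0 D (i - 1 - 1) y) dy).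
  exists x; first exact: (proj2 (d0 C (i - 1 - 1) x) dx).
  exact: (proj2 (hS D i _ _) h).
Qed.

(* Cone(f) = N (+) M[1] with differential (y, x) |-> (d y + f x, - d x). *)
Definition cpx_cone (C D : complex R) (f : cpx_map C D) : complex R.
Proof.
refine (@Complex R (fun i => (D i * C (i - 1))%type)
  (fun i x => (cpx_d D x.1 + cpx_fun f x.2, - cpx_d C x.2)) _ _).
- move=> i c x y; congr (_, _) => /=.
    by rewrite cpx_dL cpx_funL scalerDr addrACA.
  by rewrite cpx_dL opprD scalerN.
- move=> i x; congr (_, _) => /=.
    rewrite (linD _ _ (@cpx_dL _ _ _)) (linN _ (@cpx_funL _ _ _ _ _)).
    by rewrite cpx_fun_d cpx_dd add0r subrr.
  by rewrite (linN _ (@cpx_dL _ _ _)) cpx_dd !oppr0.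
Defined.

Definition dgm_cone M N (f : dgm_hom M N) : dgmod A.
Proof.
refine (@Dgmod _ A (cpx_cone f)
  (fun i j k e a x =>
     (dgm_act N e a x.1, dgm_act (dgm_shift M) e a x.2)) _ _ _ _ _).
- move=> i j k e x c a b; congr (_, _); first exact: (dgm_actLl e x.1).
  exact: (@dgm_actLl _ _ (dgm_shift M) _ _ _ e x.2).
- move=> i j k e a c x y; congr (_, _); first exact: (dgm_actLr e a).
  exact: (@dgm_actLr _ _ (dgm_shift M) _ _ _ e a).
- move=> i j k ij jk l e1 e2 e3 e4 a b x; congr (_, _); first exact: dgm_actA.
  exact: (@dgm_actA _ _ (dgm_shift M) _ _ _ _ _ _ e1 e2 e3 e4).
- move=> i e [x y]; congr (_, _); first exact: dgm_act1.
  exact: (@dgm_act1 _ _ (dgm_shift M) _ e).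
- move=> i j k e e1 e2 a x; rewrite ksign_pair; congr (_, _); last first.
    exact: (@dgm_leibniz _ _ (dgm_shift M) _ _ _ e e1 e2).
  rewrite /= (dgm_leibniz _ e1 e2) (lin_ksign _ _ (@cpx_funL _ _ _ _ _)).
  rewrite dgm_fun_act (linD _ _ (dgm_actLr _ _)) ksignD addrA.
  by congr (_ + ksign _ (dgm_act _ _ _ _)); apply: eq_irrelevance.
Defined.

Definition cpx_cone_inj (C D : complex R) (f : cpx_map C D) :
  cpx_map D (cpx_cone f).
Proof.
refine (@CpxMap _ D (cpx_cone f) (fun _ y => (y, 0)) _ _).
- by move=> i c x y; congr (_, _); rewrite /= scaler0 addr0.
- move=> i x; congr (_, _); rewrite /=.
    by rewrite (lin0 (@cpx_funL _ _ _ _ _)) addr0.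
  by rewrite (lin0 (@cpx_dL _ _ _)) oppr0.
Defined.

Definition cpx_cone_proj (C D : complex R) (f : cpx_map C D) :
  cpx_map (cpx_cone f) (cpx_shift C).
Proof.
by refine (@CpxMap _ (cpx_cone f) (cpx_shift C) (fun _ x => x.2) _ _).
Defined.

Definition dgm_cone_inj M N (f : dgm_hom M N) : dgm_hom N (dgm_cone f).
Proof.
refine (@DgmHom _ _ N (dgm_cone f) (cpx_cone_inj f) _) => i j k e a x.
congr (_, _).
by rewrite /= (lin0 (dgm_actLr _ _)) /ksign mul0rz.
Defined.

Definition dgm_cone_proj M N (f : dgm_hom M N) :
  dgm_hom (dgm_cone f) (dgm_shift M).
Proof.
by refine (@DgmHom _ _ (dgm_cone f) (dgm_shift M) (cpx_cone_proj f) _).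
Defined.

End DGModules.

(* D(A) is the localization of the category of DG modules at the
   quasi-isomorphisms: morphisms are formal composites of DG maps and of
   inverses of quasi-isomorphisms, modulo the relations [deq]. *)
Section Derived.
Variables (R : comNzRingType) (A : dga R).
Local Notation mod := (dgmod A).

Inductive dmor : mod -> mod -> Type :=
| dmap X Y (f : dgm_hom X Y) : dmor X Y
| dinv X Y (s : dgm_hom X Y) (qs : quasi_iso s) : dmor Y X
| dcomp X Y Z (g : dmor Y Z) (f : dmor X Y) : dmor X Z.

Inductive deq : forall X Y, dmor X Y -> dmor X Y -> Prop :=
| deq_refl X Y (f : dmor X Y) : deq f f
| deq_sym X Y (f g : dmor X Y) : deq f g -> deq g f
| deq_trans X Y (f g h : dmor X Y) : deq f g -> deq g h -> deq f h
| deq_comp X Y Z (g g' : dmor Y Z) (f f' : dmor X Y) :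
    deq g g' -> deq f f' -> deq (dcomp g f) (dcomp g' f')
| deq_compA X Y Z W (h : dmor Z W) (g : dmor Y Z) (f : dmor X Y) :
    deq (dcomp h (dcomp g f)) (dcomp (dcomp h g) f)
| deq_comp1m X Y (f : dmor X Y) : deq (dcomp (dmap (dgm_id Y)) f) f
| deq_compm1 X Y (f : dmor X Y) : deq (dcomp f (dmap (dgm_id X))) f
| deq_map X Y (f g : dgm_hom X Y) :
    (forall i (x : X i), cpx_fun f x = cpx_fun g x) -> deq (dmap f) (dmap g)
| deq_map_comp X Y Z (g : dgm_hom Y Z) (f : dgm_hom X Y) :
    deq (dmap (dgm_comp g f)) (dcomp (dmap g) (dmap f))
| deq_invl X Y (s : dgm_hom X Y) (qs : quasi_iso s) :
    deq (dcomp (dinv qs) (dmap s)) (dmap (dgm_id X))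
| deq_invr X Y (s : dgm_hom X Y) (qs : quasi_iso s) :
    deq (dcomp (dmap s) (dinv qs)) (dmap (dgm_id Y)).

Definition derived_cat : category :=
  @Category mod dmor deq (fun X => dmap (dgm_id X)) dcomp
    deq_refl deq_sym deq_trans deq_comp deq_comp1m deq_compm1 deq_compA.

Fixpoint dshift X Y (f : dmor X Y) : dmor (dgm_shift X) (dgm_shift Y) :=
  match f in dmor X Y return dmor (dgm_shift X) (dgm_shift Y) with
  | dmap _ _ f => dmap (dgm_hom_shift f)
  | @dinv _ _ s qs =>
      dinv (s := dgm_hom_shift s) (@quasi_iso_shift _ _ _ s qs)
  | dcomp _ _ _ g f => dcomp (dshift g) (dshift f)
  end.

Fact dshift_id X :
  deq (dshift (dmap (dgm_id X))) (dmap (dgm_id (dgm_shift X))).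
Proof. by apply: deq_map. Qed.

Fact dshift_eq X Y (f g : dmor X Y) : deq f g -> deq (dshift f) (dshift g).
Proof.
elim=> /=.
- by move=> *; apply: deq_refl.
- by move=> *; apply: deq_sym.
- by move=> ? ? f1 f2 f3 _ e1 _ e2; apply: deq_trans e1 e2.
- by move=> *; apply: deq_comp.
- by move=> *; apply: deq_compA.
- move=> X' Y' f'; apply: deq_trans (deq_comp1m (dshift f')).
  by apply: deq_comp; [apply: dshift_id | apply: deq_refl].
- move=> X' Y' f'; apply: deq_trans (deq_compm1 (dshift f')).
  by apply: deq_comp; [apply: deq_refl | apply: dshift_id].
- by move=> X' Y' f' g' e; apply: deq_map => i x; apply: e.
- move=> X' Y' Z' g' f'; apply: deq_trans (deq_map_comp _ _).
  by apply: deq_map.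
- move=> X' Y' s qs.
  by apply: deq_trans (deq_invl _) (deq_sym (dshift_id _)).
- move=> X' Y' s qs.
  by apply: deq_trans (deq_invr _) (deq_sym (dshift_id _)).
Qed.

Definition dshift_functor : functor derived_cat derived_cat :=
  @Functor derived_cat derived_cat (@dgm_shift R A) dshift dshift_eq dshift_id
    (fun _ _ _ _ _ => deq_refl _).

(* X (+) X is a coproduct in D(A); f + g is the composite of the diagonal
   with the morphism X (+) X -> Y of components f and g. *)
Definition dadd (X Y : mod) (f g h : dmor X Y) : Prop :=
  exists k : dmor (dgm_sum X X) Y,
    [/\ deq (dcomp k (dmap (dgm_inl X X))) f,
        deq (dcomp k (dmap (dgm_inr X X))) g
      & deq (dcomp k (dmap (dgm_diag X))) h].

(* The triangles isomorphic in D(A) to M -> N -> Cone(f) -> M[1] for some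
   DG map f : M -> N. *)
Definition ddist (X Y Z : derived_cat) (u : mor X Y) (v : mor Y Z)
    (w : mor Z (dshift_functor X)) : Prop :=
  exists (M N : mod) (f : dgm_hom M N)
         (a : @mor derived_cat X M) (b : @mor derived_cat Y N)
         (c : @mor derived_cat Z (dgm_cone f)),
    [/\ is_iso a, is_iso b & is_iso c] /\
    [/\ deq (dcomp b u) (dcomp (dmap f) a),
        deq (dcomp c v) (dcomp (dmap (dgm_cone_inj f)) b)
      & deq (dcomp (dshift a) w) (dcomp (dmap (dgm_cone_proj f)) c)].

Definition derived_category : tricat :=
  @Tricat derived_cat dadd dshift_functor ddist.

End Derived.

Definition derived_Morita_equivalent (R : comNzRingType) (A B : dga R) : Prop :=
  inhabited (tri_equivalence (derived_category A) (derived_category B)).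

(* A word over the generators (given by their positions in the list) with a
   name of its coefficient; a polynomial; a generator with its degree and
   differential. *)
Definition term_code : Type := seq bool * seq nat.
Definition poly_code : Type := seq term_code.
Definition semifree_code : Type := seq (int * poly_code).

Definition enc_term : term_code -> seq bool :=
  enc_pair enc_word (enc_seq enc_nat).
Definition enc_semifree : semifree_code -> seq bool :=
  enc_seq (enc_pair enc_int (enc_seq enc_term)).

Section Coding.
Variables (R : comNzRingType) (rep : seq bool -> R -> Prop).

Inductive poly_codes (G : finType) (n : nat) (x : 'I_n -> G) :
    poly_code -> tensor_alg R G -> Prop :=
| poly_codes0 : poly_codes x [::] 0
| poly_codesD w c (m : seq 'I_n) s p : rep w c -> poly_codes x s p ->
    poly_codes x ((w, [seq val i | i <- m]) :: s)
                 (c *: \prod_(i <- m) gvar R (x i) + p).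

Definition semifree_codes (P : semifree_code) (S : semifree R) : Prop :=
  exists x : 'I_(size P) -> sf_gen S,
    bijective x /\
    forall i, sf_deg S (x i) = (tnth (in_tuple P) i).1
      /\ poly_codes x (tnth (in_tuple P) i).2 (sf_d S (gvar R (x i))).

(* The machine only has to be correct on inputs that encode two semifree
   DGAs. *)
Definition decides (M : turing_machine)
    (problem : semifree R -> semifree R -> Prop) : Prop :=
  forall (P Q : semifree_code) (A B : semifree R),
    semifree_codes P A -> semifree_codes Q B ->
    let input := enc_pair enc_semifree enc_semifree (P, Q) in
    (problem A B -> tm_accepts M input) /\
    (~ problem A B -> tm_rejects M input).

Definition undecidable (problem : semifree R -> semifree R -> Prop) : Prop :=
  ~ exists M, decides M problem.

End Coding.

(* Main.v *)
From HB Require Import structures.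
Require Import Defs.
From mathcomp Require Import all_boot all_order all_algebra finmap.
From mathcomp Require Import monalg boolp.

(**
The three relations become easy once one asks whether 1 is a boundary. If it is,
say 1 = d z, then every cycle x of every DG module is the boundary of z x, so all
homology vanishes and the derived category is zero. Hence two DGAs in which 1 is
a boundary are quasi-isomorphic (through the zero DGA) and derived Morita
equivalent, and both relations preserve the property that 1 is a boundary. Two
semifree DGAs with the same generators, such that every d x is a polynomial in
generators with differential 0, are moreover stable tame isomorphic when 1 is a
boundary in both: after adding e, f with d e = f, a tame change of generators
makes d f = 1 and all other differentials 0 (straighten). Stable tame isomorphisms
preserve the property too.
So it is enough to show that no machine decides whether 1 is a boundary.

Words over an alphabet L modulo relations u = v or u = 0 give a semifree DGA:
letters in degree 0 with differential 0, and for each relation a generator of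
degree 1 with differential u - v or u. In it 1 is a boundary exactly when 1 lies in
the two-sided ideal generated by the relations. Suppose that a machine M decides
one of the problems. Its configurations are words in which a head rewrites itself
and its two neighbours. Take these rewriting rules as relations; set a window in
which M halts without accepting equal to 0; and set the start word, between an
opening and a closing bracket, equal to 1. If M rejects, then the start word
rewrites to a word that is 0, so 1 = 0 (kill_boundary). If M accepts, then the words
that rewrite to the final word form a set closed under the rules in both
directions, because rewriting is deterministic and the final word is stuck. A
stack automaton that reads brackets and checks membership of this set defines a
linear functional that kills all boundaries but not 1 (stop_not_one_boundary).

The diagonal argument needs M to run on a description of this DGA itself. The only
part of the description that depends on the start word is its last term, so it
has the form p ++ h(w) ++ t, where w is the bit string in the start word, h
substitutes a code for each bit and p, t do not depend on w. The rules
of the rewriting system first turn the stored w into w ++ h(w) ++ t and then start M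
(start_word_steps). Let w be the description of a DGA in which 1 is a boundary,
followed by p. Then M runs on the description of the pair itself
(enc_diagonal), and whatever it answers is wrong.
*)

Set Implicit Arguments.
Unset Strict Implicit.
Unset Printing Implicit Defensive.

Import GRing.Theory.
Local Open Scope fset_scope.
Local Open Scope ring_scope.

(** * Words and linear maps on the free algebra *)
Lemma linear_comp (R : comNzRingType) (U V W : lmodType R) (f : V -> W) (g : U -> V) :
  linear f -> linear g -> linear (f \o g).
Proof. by move=> fL gL c a b /=; rewrite gL fL. Qed.

Lemma linear_add (R : comNzRingType) (U V : lmodType R) (f g : U -> V) :
  linear f -> linear g -> linear (fun x => f x + g x).
Proof. by move=> fL gL c a b; rewrite fL gL scalerDr addrACA. Qed.

Section AlgebraMorphism.
Variables (R : comNzRingType) (A B : lalgType R) (F : {lrmorphism A -> B}).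

Lemma lrm_linear : linear F. Proof. exact: linearP. Qed.
Lemma lrm0 : F 0 = 0. Proof. exact: lin0 lrm_linear. Qed.
Lemma lrm1 : F 1 = 1. Proof. exact: rmorph1. Qed.
Lemma lrmD p q : F (p + q) = F p + F q. Proof. exact: linD lrm_linear. Qed.
Lemma lrmN p : F (- p) = - F p. Proof. exact: linN lrm_linear. Qed.
Lemma lrmZ c p : F (c *: p) = c *: F p. Proof. exact: linZ lrm_linear. Qed.
Lemma lrmDZ c c' p q : F (c *: p + c' *: q) = c *: F p + c' *: F q.
Proof. by rewrite lrmD !lrmZ. Qed.
Lemma lrmM p q : F (p * q) = F p * F q. Proof. exact: rmorphM. Qed.

(** The shape of the images of generators in [straighten], carried along a morphism in
one step. *)
Lemma lrm_shear x h z x' h' z' : F x = x' -> F h = h' -> F z = z' ->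
  F (1 *: x + - (h * z)) = 1 *: x' + - (h' * z').
Proof. by move=> <- <- <-; rewrite lrmD lrmZ lrmN lrmM. Qed.

End AlgebraMorphism.

Section FreeAlgebra.
Variable R : comNzRingType.
Implicit Type G : finType.

Definition gword G (m : seq G) : tensor_alg R G := << FMonom m >>.

Lemma gword_nil G : gword ([::] : seq G) = 1.
Proof. by apply/malgP => k; rewrite mcoeff1 /mone /= fmoneE mcoeffU1 eq_sym. Qed.

Lemma gword_cat G (m1 m2 : seq G) : gword (m1 ++ m2) = gword m1 * gword m2.
Proof.
rewrite /gword malgM_def fgmulUU mulr1; congr (mkmalgU _ _).
by apply: val_inj; rewrite /= fmM.
Qed.

Lemma gword1 G (x : G) : gword [:: x] = gvar R x.
Proof. by rewrite /gword /gvar fmuE. Qed.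

Lemma gword_cons G (x : G) m : gword (x :: m) = gvar R x * gword m.
Proof. by rewrite -cat1s gword_cat gword1. Qed.

Lemma gword_prod G (m : seq G) : \prod_(x <- m) gvar R x = gword m.
Proof.
by elim: m => [|x m IH]; rewrite ?big_nil ?gword_nil // big_cons gword_cons IH.
Qed.

Lemma tensorE G (p : tensor_alg R G) :
  p = \sum_(m <- msupp p) p@_m *: gword (m : seq G).
Proof.
rewrite {1}[p]monalgE; apply: eq_bigr => m _.
apply/malgP => k; rewrite mcoeffZ mcoeffU /gword mcoeffU1 mulr_natr.
by case: m.
Qed.

Section LinearExtension.
Variables (G : finType) (V : lmodType R) (f : seq G -> V).

Definition lin_ext (p : tensor_alg R G) : V := \sum_(m <- msupp p) p@_m *: f m.

Lemma lin_ext_linear : linear lin_ext.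
Proof.
have widen d (p : tensor_alg R G) : msupp p `<=` d ->
    lin_ext p = \sum_(m <- d) p@_m *: f m.
  move=> le; rewrite [LHS](big_fset_incl _ le) => //= m _ /mcoeff_outdom ->.
  by rewrite scale0r.
move=> c p q; pose d := (msupp p `|` msupp q `|` msupp (c *: p + q))%fset.
rewrite !(widen d).
- rewrite scaler_sumr -big_split /=; apply: eq_bigr => m _.
  by rewrite mcoeffD mcoeffZ scalerDl scalerA.
- exact: fsubset_trans (fsubsetUr _ _) (fsubsetUl _ _).
- exact: fsubset_trans (fsubsetUl _ _) (fsubsetUl _ _).
- exact: fsubsetUr.
Qed.

Lemma lin_ext_gword m : lin_ext (gword m) = f m.
Proof. by rewrite /lin_ext /gword msuppU1 big_seq_fset1 mcoeffUU scale1r. Qed.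

End LinearExtension.

(** An element is a combination of the words of its support; both graded pieces and
subalgebras on some of the generators are treated through this induction. *)
Lemma tensor_ind G (Q : pred (seq G)) (P : tensor_alg R G -> Prop) : P 0 ->
    (forall c m p, Q m -> P p -> P (c *: gword m + p)) ->
  forall p, {in msupp p, forall m : {fmonom G}, Q m} -> P p.
Proof.
move=> P0 PD p hp; rewrite [p]tensorE.
suff H (s : seq {fmonom G}) : {subset s <= msupp p} ->
    P (\sum_(m <- s) p@_m *: gword (m : seq G)) by apply: H.
elim: s => [|m s IH] sub; first by rewrite big_nil.
rewrite big_cons; apply: PD; first by apply/hp/sub/mem_head.
by apply: IH => k ks; apply: sub; rewrite inE ks orbT.
Qed.

Lemma linear_sumZ (U V : lmodType R) (f : U -> V) (I : Type) (s : seq I)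
    (c : I -> R) (u : I -> U) : linear f ->
  f (\sum_(i <- s) c i *: u i) = \sum_(i <- s) c i *: f (u i).
Proof.
move=> fL; elim: s => [|i s IH]; first by rewrite !big_nil (lin0 fL).
by rewrite !big_cons fL IH.
Qed.

Lemma linear_eq_gword G (V : lmodType R) (f g : tensor_alg R G -> V) :
  linear f -> linear g -> (forall m, f (gword m) = g (gword m)) -> f =1 g.
Proof.
move=> fL gL fg p; rewrite [p]tensorE !linear_sumZ //.
by apply: eq_bigr => m _; rewrite fg.
Qed.

Lemma tensor_scaleAr G (c : R) (p q : tensor_alg R G) :
  p * (c *: q) = c *: (p * q).
Proof.
apply/malgP => m; rewrite mcoeffZ [in RHS]mcoeffMl.
rewrite (mcoeffMlw _ (fsubset_refl _) (msuppZ_le c q)) mulr_sumr.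
apply: eq_bigr => k _; rewrite mulr_sumr; apply: eq_bigr => k' _.
by rewrite mcoeffZ mulrCA mulrnAr.
Qed.

Lemma mulDZl G (c : R) (a b q : tensor_alg R G) :
  (c *: a + b) * q = c *: (a * q) + b * q.
Proof. by rewrite mulrDl scalerAl. Qed.

Lemma mulDZr G (c : R) (a b q : tensor_alg R G) :
  q * (c *: a + b) = c *: (q * a) + q * b.
Proof. by rewrite mulrDr tensor_scaleAr. Qed.

Lemma linear_mulr G (q : tensor_alg R G) : linear ( *%R^~ q).
Proof. by move=> c a b; apply: mulDZl. Qed.

Lemma linear_mull G (q : tensor_alg R G) : linear ( *%R q).
Proof. by move=> c a b; apply: mulDZr. Qed.

Section AlgebraExtension.
Variables (G G' : finType) (h : G -> tensor_alg R G').

(** The universal property of the free algebra. *)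
Definition alg_ext : tensor_alg R G -> tensor_alg R G' :=
  lin_ext (fun m => \prod_(x <- m) h x).

Fact alg_ext_linear : linear alg_ext.
Proof. exact: lin_ext_linear. Qed.

Fact alg_ext1 : alg_ext 1 = 1.
Proof. by rewrite -gword_nil /alg_ext lin_ext_gword big_nil. Qed.

Fact alg_extM : {morph alg_ext : p q / p * q}.
Proof.
move=> p q; apply: (linear_eq_gword (f := fun p => alg_ext (p * q))
  (g := fun p => alg_ext p * alg_ext q)).
- exact: linear_comp alg_ext_linear (linear_mulr q).
- exact: linear_comp (linear_mulr _) alg_ext_linear.
move=> m; apply: (linear_eq_gword (f := fun q => alg_ext (gword m * q))
  (g := fun q => alg_ext (gword m) * alg_ext q)).
- exact: linear_comp alg_ext_linear (linear_mull _).
- exact: linear_comp (linear_mull _) alg_ext_linear.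
by move=> m'; rewrite -gword_cat /alg_ext !lin_ext_gword big_cat.
Qed.

HB.instance Definition _ := GRing.isLinear.Build R (tensor_alg R G)
  (tensor_alg R G') _ alg_ext alg_ext_linear.
HB.instance Definition _ := GRing.isMonoidMorphism.Build (tensor_alg R G)
  (tensor_alg R G') alg_ext (alg_ext1, alg_extM).

Lemma alg_ext_gvar x : alg_ext (gvar R x) = h x.
Proof. by rewrite -gword1 /alg_ext lin_ext_gword big_seq1. Qed.

End AlgebraExtension.
End FreeAlgebra.

(** * Derivations of the free algebra *)
Section AbstractDerivation.
Variables (R : comNzRingType) (A B : lalgType R).

Lemma ksign0 (V : zmodType) i : ksign i (0 : V) = 0.
Proof. exact: mul0rz. Qed.

Lemma ksign0z (V : zmodType) (x : V) : ksign 0 x = x.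
Proof. by rewrite /ksign expr0z mulr1z. Qed.

Lemma ksign_mull i (p q : A) : ksign i p * q = ksign i (p * q).
Proof. exact: mulrzAl. Qed.

Lemma ksign_mulr i (p q : A) : p * ksign i q = ksign i (p * q).
Proof. exact: mulrzAr. Qed.

Lemma linear_ksign (V : lmodType R) i : linear (@ksign V i).
Proof. by move=> c x y; rewrite ksignD ksignZ. Qed.

Variables (d : A -> A) (dL : linear d).

(** The Leibniz rule for one pair of elements of an arbitrary algebra with a linear map
d. The lemmas below propagate it from generators to words, and then to everything
else, by the laws of algebras alone. *)
Definition leibniz_at i (p q : A) : Prop :=
  d (p * q) = d p * q + ksign i (p * d q).

Lemma leibniz_at_linear i c p p' q :
  leibniz_at i p q -> leibniz_at i p' q -> leibniz_at i (c *: p + p') q.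
Proof.
rewrite /leibniz_at => E E'.
rewrite !mulrDl -!scalerAl !dL E E' ksignD ksignZ mulrDl -scalerAl scalerDr.
by rewrite addrACA.
Qed.

Lemma leibniz_at0 i q : leibniz_at i 0 q.
Proof. by rewrite /leibniz_at !mul0r (lin0 dL) mul0r ksign0 addr0. Qed.

Lemma leibniz_at1 q : d 1 = 0 -> leibniz_at 0 1 q.
Proof. by rewrite /leibniz_at => ->; rewrite !mul1r mul0r add0r ksign0z. Qed.

(** d d vanishes on a product because the two mixed terms d p * d q have opposite
signs. *)
Lemma leibniz_at_dd i p q : leibniz_at i p q -> leibniz_at (i - 1) (d p) q ->
  leibniz_at i p (d q) -> d (d p) = 0 -> d (d q) = 0 -> d (d (p * q)) = 0.
Proof.
rewrite /leibniz_at => E E1 E2 dp dq; rewrite E (linD _ _ dL).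
rewrite (lin_ksign _ _ dL) E1 E2 dp dq mul0r mulr0 ksign0 addr0 add0r.
by rewrite ksign_pred addNr.
Qed.

Lemma leibniz_at_assoc i j (p q r : A) :
  leibniz_at j q r -> leibniz_at i p q -> leibniz_at i p (q * r) ->
  leibniz_at (i + j) (p * q) r.
Proof.
rewrite /leibniz_at => Eqr Epq E; rewrite -mulrA E Eqr Epq -ksignM.
by rewrite mulrDr ksignD mulrDl addrA ksign_mulr ksign_mull !mulrA.
Qed.

Lemma leibniz_at_morph (d' : B -> B) (F : {lrmorphism A -> B}) i p q :
    leibniz_at i p q ->
    d' (F p * F q) = d' (F p) * F q + ksign i (F p * d' (F q)) ->
  F (d p) = d' (F p) -> F (d q) = d' (F q) -> F (d (p * q)) = d' (F (p * q)).
Proof.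
rewrite /leibniz_at => -> E' Ep Eq.
by rewrite lrmD (lin_ksign _ _ (lrm_linear F)) !lrmM E' Ep Eq.
Qed.

End AbstractDerivation.

Section Graded.
Variables (R : comNzRingType) (G : finType) (deg : G -> int).
Local Notation T := (tensor_alg R G).
Implicit Types (p q : T) (m : seq G).

Definition seq_degree m : int := \sum_(x <- m) deg x.

Lemma homog_gword m i : seq_degree m = i -> gword R m \in homog R deg i.
Proof.
move=> <-; apply/homogP => k; rewrite /gword mcoeffU1.
by case: (FMonom m =P k) => [<- //|_]; rewrite eqxx.
Qed.

Lemma homog_gvar x : gvar R x \in homog R deg (deg x).
Proof. by rewrite -gword1; apply: homog_gword; rewrite /seq_degree big_seq1. Qed.

Lemma homog_one : (1 : T) \in homog R deg 0.
Proof. by rewrite -gword_nil; apply: homog_gword; rewrite /seq_degree big_nil. Qed.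

Lemma homog_ind i (P : T -> Prop) : P 0 ->
    (forall c m p, seq_degree m = i -> P p -> P (c *: gword R m + p)) ->
  forall p, p \in homog R deg i -> P p.
Proof.
move=> P0 PD p /allP hp; apply: (tensor_ind (Q := fun m => seq_degree m == i)) => //.
by move=> c m q /eqP; apply: PD.
Qed.

Lemma homog_ksign i j p : p \in homog R deg i -> ksign j p \in homog R deg i.
Proof. by move=> hp; rewrite /ksign rpredMz. Qed.

Lemma homogDZ i c p q : p \in homog R deg i -> q \in homog R deg i ->
  c *: p + q \in homog R deg i.
Proof. by move=> hp hq; apply: rpredD hq; apply: rpredZ. Qed.

Lemma homog_mul i j k p q : i + j = k ->
  p \in homog R deg i -> q \in homog R deg j -> p * q \in homog R deg k.
Proof.
move=> e hp hq; move: p hp; apply: homog_ind; first by rewrite mul0r rpred0.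
move=> c m p dm IH; rewrite mulDZl; apply: homogDZ IH.
move: q hq; apply: homog_ind; first by rewrite mulr0 rpred0.
move=> c' m' q dm' IH; rewrite mulDZr; apply: homogDZ IH.
by rewrite -gword_cat homog_gword // /seq_degree big_cat /= -e -dm -dm'.
Qed.

Section Derivation.
Variable d0 : G -> T.

Fixpoint der_word m : T :=
  if m is x :: m' then
    d0 x * gword R m' + ksign (deg x) (gvar R x * der_word m')
  else 0.

Definition der : T -> T := lin_ext der_word.

Lemma der_linear : linear der. Proof. exact: lin_ext_linear. Qed.

Lemma der0 : der 0 = 0. Proof. exact: lin0 der_linear. Qed.

Lemma der_gword m : der (gword R m) = der_word m.
Proof. exact: lin_ext_gword. Qed.

Lemma der_gvar x : der (gvar R x) = d0 x.
Proof.
by rewrite -gword1 der_gword /= gword_nil mulr1 mulr0 ksign0 addr0.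
Qed.

(** For a single generator the rule is the definition of [der_word]; [leibniz_at_assoc]
moves further generators from the right factor to the left one. *)
Lemma der_leibniz_gword m1 m2 :
  leibniz_at der (seq_degree m1) (gword R m1) (gword R m2).
Proof.
elim: m1 => [|x m1 IH].
  rewrite /seq_degree big_nil gword_nil; apply: leibniz_at1.
  by rewrite -gword_nil der_gword.
have E m : leibniz_at der (deg x) (gvar R x) (gword R m).
  have := der_gword (x :: m); rewrite /leibniz_at gword_cons => ->.
  rewrite der_gvar der_gword; exact (erefl (der_word (x :: m))).
rewrite /seq_degree big_cons gword_cons; apply: leibniz_at_assoc IH (E m1) _.
by rewrite -gword_cat; apply: E.
Qed.

Lemma der_leibniz i p q : p \in homog R deg i -> leibniz_at der i p q.
Proof.
move: p; apply: homog_ind => [|c m p <- IH].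
  exact (leibniz_at0 der_linear i q).
apply: (leibniz_at_linear der_linear) IH.
apply: (linear_eq_gword (f := fun q => der (gword R m * q)) (g := fun q =>
  der (gword R m) * q + ksign (seq_degree m) (gword R m * der q))) q.
- exact: linear_comp der_linear (linear_mull _).
- apply: linear_add (linear_mull _) _; apply: linear_comp (linear_ksign _) _.
  exact: linear_comp (linear_mull _) der_linear.
by move=> m'; apply: der_leibniz_gword.
Qed.

Hypothesis d0_homog : forall x, d0 x \in homog R deg (deg x - 1).

Lemma der_homog i p : p \in homog R deg i -> der p \in homog R deg (i - 1).
Proof.
move: p; apply: homog_ind => [|c m p dm IH].
  by rewrite der0 rpred0.
rewrite der_linear; apply: homogDZ IH; rewrite /der lin_ext_gword.
elim: m i dm => [|x m IH] i /= dm; first by rewrite rpred0.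
rewrite -dm /seq_degree big_cons; apply: rpredD.
  apply: homog_mul (d0_homog x) (homog_gword (erefl (seq_degree m))).
  by rewrite addrAC.
by apply/homog_ksign/(homog_mul _ (homog_gvar x) (IH _ erefl)); rewrite addrA.
Qed.

Hypothesis d0_closed : forall x, der (d0 x) = 0.

Lemma der_der p : der (der p) = 0.
Proof.
apply: (linear_eq_gword (f := fun p => der (der p)) (g := fun=> 0)).
- exact: linear_comp der_linear der_linear.
- by move=> c a b; rewrite scaler0 addr0.
elim=> [|x m IH]; first by rewrite der_gword der0.
rewrite gword_cons; apply: (leibniz_at_dd der_linear) (IH).
- exact: der_leibniz (homog_gvar x).
- by rewrite der_gvar; apply: der_leibniz (d0_homog x).
- exact: der_leibniz (homog_gvar x).
- by rewrite der_gvar d0_closed.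
Qed.

Definition free_dga : semifree R :=
  Semifree der_linear der_homog der_der der_leibniz.

End Derivation.
End Graded.

Lemma semifree_d1 (R : comNzRingType) (S : semifree R) : sf_d S 1 = 0.
Proof.
have := sf_leibniz (s := S) 1 (homog_one R (sf_deg S)).
by rewrite !mulr1 mul1r ksign0z => /eqP; rewrite -subr_eq subrr eq_sym => /eqP.
Qed.

(** Commuting with the differentials can be checked on generators. The Leibniz rules
are hypotheses, so that this also applies before d' is known to square to 0. *)
Lemma chain_map_gword (R : comNzRingType) (G G' : finType) (deg : G -> int)
    (d : tensor_alg R G -> tensor_alg R G)
    (d' : tensor_alg R G' -> tensor_alg R G')
    (F : {lrmorphism tensor_alg R G -> tensor_alg R G'}) :
    linear d -> linear d' -> d 1 = 0 -> d' 1 = 0 ->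
    (forall x q, leibniz_at d (deg x) (gvar R x) q) ->
    (forall x q, leibniz_at d' (deg x) (F (gvar R x)) q) ->
    (forall x, F (d (gvar R x)) = d' (F (gvar R x))) ->
  forall p, F (d p) = d' (F p).
Proof.
move=> dL d'L d1 d'1 dx d'x Fx; apply: linear_eq_gword.
- exact: linear_comp (lrm_linear F) dL.
- exact: linear_comp d'L (lrm_linear F).
elim=> [|x m IH]; first by rewrite gword_nil d1 lrm0 lrm1.
rewrite gword_cons.
exact: leibniz_at_morph (dx x _) (d'x x _) (Fx x) IH.
Qed.

Lemma chain_map_gen (R : comNzRingType) (S S' : semifree R)
    (F : {lrmorphism sf_alg S -> sf_alg S'}) :
    (forall x, F (gvar R x) \in homog R (sf_deg S') (sf_deg S x)) ->
    (forall x, F (sf_d S (gvar R x)) = sf_d S' (F (gvar R x))) ->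
  forall p, F (sf_d S p) = sf_d S' (F p).
Proof.
move=> Fh; apply: (@chain_map_gword _ _ _ (sf_deg S) _ _ F).
- exact: sf_dL.
- exact: sf_dL.
- exact: semifree_d1.
- exact: semifree_d1.
- by move=> x q; apply: sf_leibniz (homog_gvar _ _ x).
- by move=> x q; apply: sf_leibniz (Fh x).
Qed.

Lemma lrm_homog (R : comNzRingType) (G G' : finType) (deg : G -> int)
    (deg' : G' -> int) (F : {lrmorphism tensor_alg R G -> tensor_alg R G'}) :
    (forall x, F (gvar R x) \in homog R deg' (deg x)) ->
  forall i p, p \in homog R deg i -> F p \in homog R deg' i.
Proof.
move=> Fh i; apply: homog_ind => [|c m p dm IH]; first by rewrite lrm0 rpred0.
rewrite lrmD lrmZ; apply: homogDZ IH; rewrite -dm.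
elim: m {dm} => [|x m IH].
  by rewrite gword_nil lrm1 /seq_degree big_nil homog_one.
rewrite gword_cons lrmM; apply: homog_mul (Fh x) IH.
by rewrite /seq_degree big_cons.
Qed.

(** * Supports of words and tame automorphisms *)
Section Tame.
Variable R : comNzRingType.

(** The subalgebra generated by the letters in L. *)
Definition word_supp (G : finType) (L : {pred G}) : {pred tensor_alg R G} :=
  fun p => all (fun m : {fmonom G} => all (mem L) (m : seq G)) (msupp p).

Section WordSupport.
Variables (G : finType) (L : {pred G}).
Local Notation supp := (word_supp L).

Lemma word_supp0 : 0 \in supp.
Proof. by rewrite unfold_in msupp0; apply/allP => m; rewrite inE. Qed.

Lemma word_suppDZ c p q : p \in supp -> q \in supp -> c *: p + q \in supp.
Proof.
move=> /allP hp /allP hq; apply/allP => m /(fsubsetP (msuppD_le _ _)).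
by rewrite in_fsetU => /orP[/(fsubsetP (msuppZ_le _ _))/hp|/hq].
Qed.

Lemma word_supp_gword m : all (mem L) m -> gword R m \in supp.
Proof.
move=> mL; apply/allP => k; rewrite /gword msuppU1.
by rewrite inE => /eqP ->.
Qed.

Lemma word_supp_gvar x : x \in L -> gvar R x \in supp.
Proof. by move=> xL; rewrite -gword1; apply: word_supp_gword; rewrite /= andbT. Qed.

Lemma word_supp_ind (P : tensor_alg R G -> Prop) : P 0 ->
    (forall c m p, all (mem L) m -> P p -> P (c *: gword R m + p)) ->
  forall p, p \in supp -> P p.
Proof. by move=> P0 PD p /allP hp; apply: (tensor_ind (Q := all (mem L))). Qed.

Lemma word_supp_mul p q : p \in supp -> q \in supp -> p * q \in supp.
Proof.
move=> hp hq; move: p hp; apply: word_supp_ind; first by rewrite mul0r word_supp0.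
move=> c m p dm IH; rewrite mulDZl; apply: word_suppDZ IH.
move: q hq; apply: word_supp_ind; first by rewrite mulr0 word_supp0.
move=> c' m' q dm' IH; rewrite mulDZr; apply: word_suppDZ IH.
by rewrite -gword_cat word_supp_gword // all_cat; apply/andP.
Qed.

Lemma word_suppN p : p \in supp -> - p \in supp.
Proof. by move=> hp; rewrite -scaleN1r -[_ *: _]addr0 word_suppDZ ?word_supp0. Qed.

End WordSupport.

Lemma lrm_word_supp (G G' : finType) (L : {pred G}) (L' : {pred G'})
    (F : {lrmorphism tensor_alg R G -> tensor_alg R G'}) p :
    {in L, forall x, F (gvar R x) \in word_supp L'} -> p \in word_supp L ->
  F p \in word_supp L'.
Proof.
move=> FL; move: p; apply: word_supp_ind => [|c m p mL IH].
  by rewrite lrm0 word_supp0.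
rewrite lrmD lrmZ; apply: word_suppDZ IH.
elim: m mL => [|x m IH] /=; last case/andP=> xL /IH.
  by rewrite gword_nil lrm1 -gword_nil word_supp_gword.
by rewrite gword_cons lrmM; apply: word_supp_mul; apply: FL.
Qed.

Lemma lrmorphism_word_supp (G G' : finType) (L : {pred G})
    (F F' : {lrmorphism tensor_alg R G -> tensor_alg R G'}) p :
    {in L, forall x, F (gvar R x) = F' (gvar R x)} -> p \in word_supp L ->
  F p = F' p.
Proof.
move=> FL /allP pL; rewrite [p]tensorE.
rewrite (linear_sumZ _ _ _ (lrm_linear F)) (linear_sumZ _ _ _ (lrm_linear F')).
apply: eq_big_seq => m /pL /allP mL; congr (_ *: _).
elim: (m : seq G) mL => [|x s IH] sL; first by rewrite gword_nil !lrm1.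
rewrite gword_cons !lrmM FL; last by apply: sL; rewrite mem_head.
by rewrite IH // => y ys; apply: sL; rewrite inE ys orbT.
Qed.

Lemma lrmorphism_eq (G G' : finType)
    (F F' : {lrmorphism tensor_alg R G -> tensor_alg R G'}) :
  (forall x, F (gvar R x) = F' (gvar R x)) -> F =1 F'.
Proof.
move=> FF' p; apply: (@lrmorphism_word_supp G G' predT) => [x _|]; first exact: FF'.
by apply/allP => m _; apply/allP.
Qed.

Variable S : semifree R.
Local Notation G := (sf_gen S).
Local Notation T := (sf_alg S).

Definition shear (x : G) (a : R) (p : T) : {lrmorphism T -> T} :=
  alg_ext (fun y => if y == x then a *: gvar R x + p else gvar R y).

Lemma shearE x a p : shear x a p (gvar R x) = a *: gvar R x + p.
Proof. by rewrite /shear /= alg_ext_gvar eqxx. Qed.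

Lemma shear_fix x a p y : y != x -> shear x a p (gvar R y) = gvar R y.
Proof. by move=> yx; rewrite /shear /= alg_ext_gvar (negPf yx). Qed.

Lemma elementary_shear x a p : (exists b, a * b = 1) ->
    p \in homog R (sf_deg S) (sf_deg S x) -> p \in word_supp (predC1 x) ->
  elementary (shear x a p).
Proof.
move=> a1 ph /allP px; exists x, a, p; split=> //; last first.
- by move=> y yx; apply: shear_fix.
- exact: shearE.
by move=> m /px /allP mx; apply/negP => /mx /=; rewrite inE eqxx.
Qed.

Lemma affine_cancel (V : lmodType R) (a b : R) (z q : V) : a * b = 1 ->
  a *: (b *: z + (- b) *: q) + q = z.
Proof.
by move=> ab; rewrite scalerDr !scalerA mulrN ab scale1r scaleN1r subrK.
Qed.

Lemma affine_cancelr (V : lmodType R) (a b : R) (z q : V) : a * b = 1 ->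
  b *: (a *: z + q) + (- b) *: q = z.
Proof.
by move=> ab; rewrite scalerDr scalerA mulrC ab scale1r scaleNr addrK.
Qed.

(** The inverse of x |-> a x + p is x |-> b x - b p, where a b = 1; both fix p, as x
does not occur in it. *)
Lemma elementary_inverse (phi : {lrmorphism T -> T}) : elementary phi ->
  exists psi : {lrmorphism T -> T},
    [/\ elementary psi, cancel phi psi & cancel psi phi].
Proof.
case=> x [a [p [[b ab] ph px phix phiy]]].
have pS : p \in word_supp (predC1 x).
  apply/allP => m /px mx; apply/allP => y ym /=; rewrite inE.
  by apply: contraNneq mx => <-.
have fixp (F : {lrmorphism T -> T}) :
    (forall y, y != x -> F (gvar R y) = gvar R y) -> F p = p.
  by move=> Fx; apply: (lrmorphism_word_supp (F' := idfun) _ pS).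
pose psi := shear x b (- b *: p).
have psip : psi p = p by apply: fixp => y; apply: shear_fix.
exists psi; split.
- apply: elementary_shear; first by exists a; rewrite mulrC.
    by rewrite rpredZ.
  by apply/allP => m /(fsubsetP (msuppZ_le _ _)); move/allP: pS; apply.
- apply: (lrmorphism_eq (F := psi \o phi) (F' := idfun)) => y /=.
  have [->|yx] := eqVneq y x; last by rewrite phiy // /psi shear_fix.
  rewrite phix lrmD lrmZ psip shearE.
  move: (gvar R x) p {phix ph px pS fixp psip psi} => z q.
  exact: affine_cancel ab.
- apply: (lrmorphism_eq (F := phi \o psi) (F' := idfun)) => y /=.
  have [->|yx] := eqVneq y x; last by rewrite /psi shear_fix // phiy.
  rewrite shearE lrmDZ phix (fixp phi) //.
  move: (gvar R x) p {phix ph px pS fixp psip psi} => z q.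
  exact: affine_cancelr ab.
Qed.

Lemma tame_automorphism_comp (f g : T -> T) :
  tame_automorphism f -> tame_automorphism g ->
  exists2 h, tame_automorphism h & h =1 f \o g.
Proof.
move=> tf tg; elim: tf => [|phi psi ephi _ [h th hE]]; first by exists g.
exists (phi \o h); first exact: tame_comp.
by move=> p /=; rewrite hE.
Qed.

Lemma elementary_tame (phi : {lrmorphism T -> T}) :
  elementary phi -> tame_automorphism phi.
Proof. by move=> ephi; apply: (tame_comp ephi (@tame_id _ S)). Qed.

Lemma tame_automorphism_inverse (f : T -> T) : tame_automorphism f ->
  exists g, [/\ tame_automorphism g, cancel f g & cancel g f].
Proof.
elim=> [|phi psi ephi _ [g [tg gK Kg]]]; first by exists id; split=> //; apply: tame_id.
have [phi' [ephi' K1 K2]] := elementary_inverse ephi.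
have [h th hE] := tame_automorphism_comp tg (elementary_tame ephi').
exists h; split=> // p; first by rewrite hE /= K1 gK.
by rewrite /= hE /= Kg K2.
Qed.

End Tame.

(** * Stable tame isomorphism when 1 is a boundary *)
Section Straighten.
Variables (R : comNzRingType) (G : finType) (deg : G -> int).
Local Notation T := (tensor_alg R G).
Local Notation G2 := (G + bool)%type.
Local Notation T2 := (tensor_alg R G2).
Local Notation e := (inr true : G2).
Local Notation f := (inr false : G2).

(** The degrees of the two new generators e and f. The proof needs f in degree 1, so
that it can be made to bound 1. *)
Definition stab_deg (z : G2) : int :=
  match z with inl x => deg x | inr b => if b then 1 + 1 else 1 end.

Definition stab_inj : {lrmorphism T -> T2} :=
  alg_ext (fun x => gvar R (inl x : G2)).

Lemma stab_injE x : stab_inj (gvar R x) = gvar R (inl x : G2).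
Proof. by rewrite /stab_inj /= alg_ext_gvar. Qed.

Lemma stab_inj_homog i p : p \in homog R deg i -> stab_inj p \in homog R stab_deg i.
Proof.
apply: lrm_homog => x; rewrite stab_injE; exact: (homog_gvar R stab_deg (inl x)).
Qed.

(** The differential with d f = 1 and 0 on all other generators. *)
Definition std_d (z : G2) : T2 := if z == f then 1 else 0.

Fact std_d_homog z : std_d z \in homog R stab_deg (stab_deg z - 1).
Proof.
rewrite /std_d; case: eqP => [->|_]; last exact: rpred0.
by rewrite subrr homog_one.
Qed.

Fact std_d_closed z : der stab_deg std_d (std_d z) = 0.
Proof.
rewrite /std_d; case: eqP => _; last exact: der0.
by rewrite -gword_nil der_gword.
Qed.

Definition std_dga : semifree R := free_dga std_d_homog std_d_closed.

Section Stabilize.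
Variable d0 : G -> T.
Hypothesis d0_homog : forall x, d0 x \in homog R deg (deg x - 1).
Hypothesis d0_closed : forall x, der deg d0 (d0 x) = 0.

Definition stab_d (z : G2) : T2 :=
  match z with
  | inl x => stab_inj (d0 x)
  | inr b => if b then gvar R f else 0
  end.

Fact stab_d_homog z : stab_d z \in homog R stab_deg (stab_deg z - 1).
Proof.
case: z => [x|[]] /=; first exact: stab_inj_homog.
  by rewrite addrK; apply: (homog_gvar R stab_deg f).
exact: rpred0.
Qed.

Lemma stab_inj_der p : stab_inj (der deg d0 p) = der stab_deg stab_d (stab_inj p).
Proof.
apply: (@chain_map_gword _ _ _ deg _ _ stab_inj).
- exact: der_linear.
- exact: der_linear.
- by rewrite -gword_nil der_gword.
- by rewrite -gword_nil der_gword.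
- by move=> x q; apply: der_leibniz (homog_gvar _ _ x).
- move=> x q; rewrite stab_injE.
  exact: der_leibniz (homog_gvar R stab_deg (inl x)).
- by move=> x; rewrite stab_injE !der_gvar.
Qed.

Fact stab_d_closed z : der stab_deg stab_d (stab_d z) = 0.
Proof.
case: z => [x|[]] /=; last exact: der0; last by rewrite der_gvar.
by rewrite -stab_inj_der d0_closed lrm0.
Qed.

Definition stab_dga : semifree R := free_dga stab_d_homog stab_d_closed.

Lemma stab_dgaP : stabilization (free_dga d0_homog d0_closed) stab_dga.
Proof.
exists 1, id, stab_inj; split=> //.
- by exists id.
- exact: stab_injE.
- by move=> x; split=> //; rewrite -stab_injE; apply: esym (stab_inj_der _).
- by split; apply: der_gvar.
Qed.

Variables (low : {pred G}) (u : T).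
Hypothesis d0_low : forall x, x \in low -> d0 x = 0.
Hypothesis d0_supp : forall x, d0 x \in word_supp low.
Hypothesis u_homog : u \in homog R deg 1.
Hypothesis du : der deg d0 u = 1.

Local Notation tame := (@tame_automorphism R std_dga).
Local Notation iota := stab_inj.

Lemma lrm_fix_stab_inj (F : {lrmorphism T2 -> T2}) (L : {pred G}) p :
    {in L, forall x, F (gvar R (inl x : G2)) = gvar R (inl x : G2)} ->
  p \in word_supp L -> F (iota p) = iota p.
Proof.
move=> FL; apply: (lrmorphism_word_supp (F := F \o iota) (F' := iota)) => x xL.
by rewrite /= -!/(iota _) !stab_injE FL.
Qed.

Lemma word_supp_all (p : T) : p \in word_supp predT.
Proof. by apply/allP => m _; apply/allP. Qed.

Lemma stab_inj_supp b p : iota p \in word_supp (predC1 (inr b : G2)).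
Proof.
apply: lrm_word_supp (word_supp_all p) => x _; rewrite stab_injE.
exact: word_supp_gvar.
Qed.

Lemma stab_homogN i (p : T2) : p \in homog R stab_deg i -> - p \in homog R stab_deg i.
Proof. by move=> hp; rewrite rpredN. Qed.

Lemma shear_unit : exists b : R, 1 * b = 1. Proof. by exists 1; rewrite mulr1. Qed.

(** x |-> x - f d(x). Once f bounds 1, the element f d(x) has the same boundary as x. *)
Definition relator_shear (x : G) : {lrmorphism T2 -> T2} :=
  shear (S := std_dga) (inl x) 1 (- (gvar R f * iota (d0 x))).

Lemma relator_shearE x : relator_shear x (gvar R (inl x : G2)) =
  1 *: gvar R (inl x : G2) + - (gvar R f * iota (d0 x)).
Proof. exact: (shearE (S := std_dga)). Qed.

Lemma relator_shear_fix x z : z != inl x -> relator_shear x (gvar R z) = gvar R z.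
Proof. exact: (shear_fix (S := std_dga)). Qed.

Lemma elementary_relator_shear x : elementary (S := std_dga) (relator_shear x).
Proof.
apply: elementary_shear shear_unit _ _.
  apply: stab_homogN; apply: (homog_mul (i := 1) (j := deg x - 1)).
  - by rewrite addrC subrK.
  - exact: (homog_gvar R stab_deg f).
  - exact: stab_inj_homog.
apply/word_suppN/word_supp_mul; first exact: word_supp_gvar.
have [xlow|xlow] := boolP (x \in low); first by rewrite d0_low // lrm0 word_supp0.
apply: lrm_word_supp (d0_supp x) => y ylow; rewrite stab_injE.
apply: word_supp_gvar; rewrite inE; apply: contraNneq xlow.
by case=> <-.
Qed.

(** Only generators outside low are sheared: these do not occur in any d(x), so the
shears do not disturb each other. *)
Lemma relator_shears (s : seq G) : uniq s -> all (predC low) s ->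
  exists F : {lrmorphism T2 -> T2},
  [/\ tame F, forall b, F (gvar R (inr b : G2)) = gvar R (inr b : G2)
    & forall x, F (gvar R (inl x : G2)) =
        if x \in s then 1 *: gvar R (inl x : G2) + - (gvar R f * iota (d0 x))
        else gvar R (inl x : G2)].
Proof.
elim: s => [|x s IH] /=; first by exists idfun; split=> //; apply: tame_id.
case/andP=> xs us /andP[xlow /(IH us)[F [tF Ff Fx]]]; exists (relator_shear x \o F).
split=> [|b|y].
- exact: tame_comp (elementary_relator_shear x) tF.
- change (relator_shear x (F (gvar R (inr b : G2))) = gvar R (inr b : G2)).
  by rewrite Ff relator_shear_fix.
change (relator_shear x (F (gvar R (inl y : G2))) = if y \in x :: s
  then 1 *: gvar R (inl y : G2) + - (gvar R f * iota (d0 y))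
  else gvar R (inl y : G2)).
rewrite Fx inE.
have [->|yx] := eqVneq y x; first by rewrite (negPf xs) relator_shearE.
have fixy : relator_shear x (gvar R (inl y : G2)) = gvar R (inl y : G2).
  by rewrite relator_shear_fix //; apply: contraNneq yx => -[->].
rewrite orFb; case: ifP => _; last exact: fixy.
apply: (lrm_shear (F := relator_shear x)); first exact: fixy.
  exact: relator_shear_fix.
apply: lrm_fix_stab_inj (d0_supp y) => z zlow.
rewrite relator_shear_fix //; apply: contraNneq xlow => -[<-]; exact: zlow.
Qed.

(** If d h = 1 and z = d x is a cycle, then h z bounds z as well, and x - h z is a
cycle. *)
Lemma contraction_cycle (A : lalgType R) (d : A -> A) i (h x z : A) : linear d ->
  leibniz_at d i h z -> d h = 1 -> d x = z -> d z = 0 ->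
  d (1 *: x + - (h * z)) = 0.
Proof.
move=> dL E dh dx dz; rewrite scale1r (linD _ _ dL) (linN _ dL) E dh dx dz.
by rewrite mul1r mulr0 ksign0 addr0 subrr.
Qed.

(** Psi is f |-> f + u, e |-> e - u f and x |-> x - (f + u) d(x), where d u = 1. The
element h = f + u bounds 1, since d f = 0 after the stabilization; the other images
are cycles by [contraction_cycle]. Psi consists of the shears of the x along f, followed
by f |-> f + u and by e |-> e - u f, which are elementary because u contains
neither e nor f. *)
Lemma straighten : exists2 Psi, tame Psi & forall p,
  Psi (der stab_deg std_d p) = der stab_deg stab_d (Psi p).
Proof.
have [] := @relator_shears [seq x <- enum G | x \notin low].
- by rewrite filter_uniq ?enum_uniq.
- exact: filter_all.
move=> F [tF Fb Fx].
pose chi_f : {lrmorphism T2 -> T2} := shear (S := std_dga) f 1 (iota u).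
pose chi_e : {lrmorphism T2 -> T2} :=
  shear (S := std_dga) e 1 (- (iota u * gvar R f)).
have fh := homog_gvar R stab_deg f.
have uh := stab_inj_homog u_homog.
have el_f : elementary (S := std_dga) chi_f.
  apply: elementary_shear shear_unit _ _; first exact: uh.
  exact: stab_inj_supp.
have el_e : elementary (S := std_dga) chi_e.
  apply: elementary_shear shear_unit _ _.
    by apply: stab_homogN; apply: homog_mul uh fh.
  apply/word_suppN/word_supp_mul; first exact: stab_inj_supp.
  exact: word_supp_gvar.
pose h := gvar R f + iota u.
have chi_f_inl x : chi_f (gvar R (inl x : G2)) = gvar R (inl x : G2).
  by rewrite [LHS]shear_fix.
have chi_e_inl x : chi_e (gvar R (inl x : G2)) = gvar R (inl x : G2).
  by rewrite [LHS]shear_fix.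
have chi_f_iota p : chi_f (iota p) = iota p.
  exact: lrm_fix_stab_inj (fun x _ => chi_f_inl x) (word_supp_all p).
have chi_e_iota p : chi_e (iota p) = iota p.
  exact: lrm_fix_stab_inj (fun x _ => chi_e_inl x) (word_supp_all p).
have chi_e_f : chi_e (gvar R f) = gvar R f by rewrite [LHS]shear_fix.
have chi_f_f : chi_f (gvar R f) = h.
  by rewrite [LHS]shearE scale1r.
have chi_e_h : chi_e h = h.
  exact: etrans (lrmD _ _ _) (congr2 +%R chi_e_f (chi_e_iota u)).
pose Psi : {lrmorphism T2 -> T2} := chi_e \o (chi_f \o F).
have Psi_f : Psi (gvar R f) = h.
  by change (chi_e (chi_f (F (gvar R f))) = h); rewrite Fb chi_f_f chi_e_h.
have Psi_e : Psi (gvar R e) = 1 *: gvar R e + - (iota u * gvar R f).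
  change (chi_e (chi_f (F (gvar R e))) =
    1 *: gvar R e + - (iota u * gvar R f)); rewrite Fb.
  have -> : chi_f (gvar R e) = gvar R e by rewrite [LHS]shear_fix.
  by rewrite [LHS]shearE.
have Psi_x x : Psi (gvar R (inl x : G2)) =
    if x \notin low then 1 *: gvar R (inl x : G2) + - (h * iota (d0 x))
    else gvar R (inl x : G2).
  change (chi_e (chi_f (F (gvar R (inl x : G2)))) = if x \notin low
    then 1 *: gvar R (inl x : G2) + - (h * iota (d0 x))
    else gvar R (inl x : G2)).
  move: (Fx x); rewrite mem_filter mem_enum andbT.
  case: (x \notin low) => ->.
    have Ef := lrm_shear (chi_f_inl x) chi_f_f (chi_f_iota (d0 x)).
    exact: etrans (congr1 chi_e Ef)
      (lrm_shear (chi_e_inl x) chi_e_h (chi_e_iota (d0 x))).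
  exact: etrans (congr1 chi_e (chi_f_inl x)) (chi_e_inl x).
have hh : h \in homog R stab_deg 1 by apply: rpredD.
have dL := der_linear stab_deg stab_d.
have dh : der stab_deg stab_d h = 1.
  by rewrite /h (linD _ _ dL) -stab_inj_der du lrm1 der_gvar add0r.
exists Psi.
  exact: tame_comp el_e (tame_comp el_f tF).
have Psi_homog z : Psi (gvar R z) \in homog R stab_deg (stab_deg z).
  case: z => [x|[]]; [rewrite Psi_x | rewrite Psi_e | rewrite Psi_f]; last exact: hh.
  - case: (x \notin low); last exact: (homog_gvar R stab_deg (inl x)).
    apply: homogDZ; first exact: (homog_gvar R stab_deg (inl x)).
    apply/stab_homogN/(homog_mul _ hh (stab_inj_homog (d0_homog x))).
    by rewrite addrC subrK.
  - apply: homogDZ; first exact: (homog_gvar R stab_deg e).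
    by apply/stab_homogN; apply: homog_mul uh fh.
have std_d_rest z : z != f -> std_d z = 0 by rewrite /std_d => /negPf ->.
apply: (@chain_map_gen R std_dga stab_dga Psi) => [|z]; first exact: Psi_homog.
change (Psi (der stab_deg std_d (gvar R z)) =
  der stab_deg stab_d (Psi (gvar R z))); rewrite der_gvar.
case: z => [x|[]].
- rewrite (std_d_rest (inl x) isT); apply: etrans (lrm0 Psi) (esym _).
  rewrite Psi_x; case: (boolP (x \in low)) => xlow; last first.
    apply: (contraction_cycle dL (der_leibniz _ _ hh) dh); first exact: der_gvar.
    by rewrite -stab_inj_der d0_closed lrm0.
  change (der stab_deg stab_d (gvar R (inl x : G2)) = 0).
  by rewrite der_gvar /stab_d d0_low // lrm0.
- rewrite (std_d_rest e isT); apply: etrans (lrm0 Psi) (esym _).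
  rewrite Psi_e; apply: (contraction_cycle dL (der_leibniz _ _ uh)).
  + by rewrite -stab_inj_der du lrm1.
  + exact: der_gvar.
  + exact: der_gvar.
- rewrite Psi_f dh; exact: lrm1.
Qed.

End Stabilize.
End Straighten.

(** Being tame does not depend on the differential. *)
Lemma tame_free_dga (R : comNzRingType) (G : finType) (deg : G -> int)
    d d' dh dh' dc dc' (f : tensor_alg R G -> tensor_alg R G) :
  tame_automorphism (S := @free_dga R G deg d dh dc) f ->
  tame_automorphism (S := @free_dga R G deg d' dh' dc') f.
Proof.
elim=> [|phi psi ephi _ tpsi]; first exact: tame_id.
exact: (@tame_comp R (free_dga dh' dc') phi psi ephi tpsi).
Qed.

Lemma tame_isomorphic_free_dga (R : comNzRingType) (G : finType)
    (deg : G -> int) d0 d d' dh0 dh dh' dc0 dc dc' f :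
  tame_automorphism (S := @free_dga R G deg d0 dh0 dc0) f ->
  (forall p, f (der deg d p) = der deg d' (f p)) ->
  tame_isomorphic (@free_dga R G deg d dh dc) (@free_dga R G deg d' dh' dc').
Proof.
move=> tf fE.
pose r : {lrmorphism tensor_alg R G -> tensor_alg R G} := idfun.
exists f, id, r; split.
- exact: tame_free_dga tf.
- by split; first exists id.
- by move=> x; exact (erefl (gvar R x)).
- exact fE.
Qed.

Section StableTame.
Variables (R : comNzRingType) (G : finType) (deg : G -> int).

(** Both stabilizations are tamely isomorphic to the same [std_dga]. *)
Lemma stable_tame_of_one_boundary (low : {pred G}) d d' dh dh' dc dc' :
    (forall x, x \in low -> d x = 0) -> (forall x, d x \in word_supp low) ->
    (forall x, x \in low -> d' x = 0) -> (forall x, d' x \in word_supp low) ->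
    (exists2 u, u \in homog R deg 1 & der deg d u = 1) ->
    (exists2 u, u \in homog R deg 1 & der deg d' u = 1) ->
  stable_tame_isomorphic (@free_dga R G deg d dh dc) (@free_dga R G deg d' dh' dc').
Proof.
move=> dlow dsupp d'low d'supp [u uh du] [u' u'h du'].
have [Psi tPsi PsiE] := straighten dh dc dlow dsupp uh du.
have [Psi' tPsi' Psi'E] := straighten dh' dc' d'low d'supp u'h du'.
have [Phi [tPhi PhiK PsiK]] := tame_automorphism_inverse tPsi.
have [F tF FE] := tame_automorphism_comp tPsi' tPhi.
exists (stab_dga dh dc), (stab_dga dh' dc'); split.
- exact: stab_more (stab_none _) (stab_dgaP dh dc).
- exact: stab_more (stab_none _) (stab_dgaP dh' dc').
have := @tame_isomorphic_free_dga R _ (stab_deg deg) _ _ _ (std_d_homog R deg)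
  (stab_d_homog dh) (stab_d_homog dh') (std_d_closed R deg) (stab_d_closed dc)
  (stab_d_closed dc') F tF.
apply => p.
rewrite FE [F p]FE.
change (Psi' (Phi (der (stab_deg deg) (stab_d d) p)) =
  der (stab_deg deg) (stab_d d') (Psi' (Phi p))).
move: (Phi p) (PsiK p) => q <-.
apply: etrans (congr1 (fun r => Psi' (Phi r)) (esym (PsiE q))) _.
by rewrite PhiK Psi'E.
Qed.

End StableTame.

(** * Invariance, and quasi-isomorphism *)
Section StableTameInvariant.
Variable R : comNzRingType.

Definition one_boundary (S : semifree R) : Prop := exists u, sf_d S u = 1.

Lemma chain_map_one_boundary (S S' : semifree R) (F : sf_alg S -> sf_alg S') :
  F 1 = 1 -> (forall p, F (sf_d S p) = sf_d S' (F p)) ->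
  one_boundary S -> one_boundary S'.
Proof. by move=> F1 FE [u du]; exists (F u); rewrite -FE du F1. Qed.

Section Stabilization.
Variables S S' : semifree R.
Hypothesis stabS : stabilization S S'.

Lemma stabilization_one_boundary : one_boundary S -> one_boundary S'.
Proof.
have [k [g [j [gbij jx gx _ _]]]] := stabS.
apply: (chain_map_one_boundary (lrm1 j)); apply: chain_map_gen => x.
  by rewrite jx -(gx x).1; apply: homog_gvar.
by rewrite jx (gx x).2.
Qed.

(** Killing the two new generators is a morphism of DGAs back to S. *)
Lemma one_boundary_of_stabilization : one_boundary S' -> one_boundary S.
Proof.
have [k [g [j [[g' gK Kg] jx gx [dege degf] [de df]]]]] := stabS.
pose F : {lrmorphism sf_alg S' -> sf_alg S} :=
  alg_ext (fun z => if g' z is inl x then gvar R x else 0).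
have Fl x : F (gvar R (g (inl x))) = gvar R x.
  by rewrite [LHS]alg_ext_gvar gK.
have Fr b : F (gvar R (g (inr b))) = 0 by rewrite [LHS]alg_ext_gvar gK.
have Fj p : F (j p) = p.
  apply: (lrmorphism_eq (F := F \o j) (F' := idfun)) => x.
  by change (F (j (gvar R x)) = gvar R x); rewrite jx Fl.
apply: (chain_map_one_boundary (lrm1 F)); apply: chain_map_gen => z; rewrite -(Kg z).
  case: (g' z) => [x|b]; last by rewrite Fr; apply: rpred0.
  by rewrite Fl (gx x).1; apply: homog_gvar.
case: (g' z) => [x|[]].
- by rewrite (gx x).2 Fj Fl.
- by rewrite de !Fr; apply: esym (lin0 (@sf_dL _ S)).
- by rewrite df Fr; apply: etrans (lrm0 F) (esym (lin0 (@sf_dL _ S))).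
Qed.

End Stabilization.

Lemma tame_automorphism1 (S : semifree R) (f : sf_alg S -> sf_alg S) :
  tame_automorphism f -> f 1 = 1.
Proof.
by elim=> // phi psi _ _ psi1; change (phi (psi 1) = 1); rewrite psi1 lrm1.
Qed.

Lemma iterated_stabilization_one_boundary (S S' : semifree R) :
  iterated_stabilization S S' -> one_boundary S <-> one_boundary S'.
Proof.
elim=> // {}S' S'' _ IH stab; split=> [/(proj1 IH)|].
  exact: stabilization_one_boundary.
by move=> /(one_boundary_of_stabilization stab); apply: (proj2 IH).
Qed.

Lemma stable_tame_one_boundary (S S' : semifree R) :
  stable_tame_isomorphic S S' -> one_boundary S -> one_boundary S'.
Proof.
case=> S1 [S1' [itS itS' [f [s [r [tf _ _ fE]]]]]] uS.
apply: (proj2 (iterated_stabilization_one_boundary itS')).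
apply: (chain_map_one_boundary (F := fun p => r (f p))) _ fE _.
  by rewrite (tame_automorphism1 tf) lrm1.
exact: (proj1 (iterated_stabilization_one_boundary itS)).
Qed.

End StableTameInvariant.

Section Homology.
Variable R : comNzRingType.
Implicit Types C D : complex R.

Definition acyclic C : Prop := forall i (x : C (i - 1)), cpx_d C x = 0 ->
  exists y : C i, cpx_d C y = x.

Section Homologous.
Variables (C : complex R) (i : int).
Implicit Types x y : C (i - 1).

Lemma homologous_refl x : homologous x x.
Proof. by exists 0; rewrite subrr (lin0 (@cpx_dL _ C i)). Qed.

Lemma homologous_sym x y : homologous x y -> homologous y x.
Proof. by case=> z xy; exists (- z); rewrite (linN _ (@cpx_dL _ C i)) -xy opprB. Qed.

Lemma homologous_trans x y z : homologous x y -> homologous y z -> homologous x z.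
Proof.
case=> a xy [b yz]; exists (a + b).
by rewrite (linD _ _ (@cpx_dL _ C i)) -xy -yz addrA subrK.
Qed.

End Homologous.

Lemma cpx_map0 C D (f : cpx_map C D) i : cpx_fun f (0 : C i) = 0.
Proof. exact: lin0 (@cpx_funL _ _ _ f i). Qed.

Lemma cpx_fun_cycle C D (f : cpx_map C D) i (x : C i) :
  cpx_d C x = 0 -> cpx_d D (cpx_fun f x) = 0.
Proof. by move=> dx; rewrite -cpx_fun_d dx cpx_map0. Qed.

Lemma homologous_map C D (f : cpx_map C D) i (x y : C (i - 1)) :
  homologous x y -> homologous (cpx_fun f x) (cpx_fun f y).
Proof.
case=> z xy; exists (cpx_fun f z); rewrite -cpx_fun_d -xy.
by rewrite (linD _ _ (@cpx_funL _ _ _ f _)) (linN _ (@cpx_funL _ _ _ f _)).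
Qed.

Lemma acyclic_homologous C i (x y : C (i - 1)) : acyclic C ->
  cpx_d C x = 0 -> cpx_d C y = 0 -> homologous x y.
Proof.
move=> aC dx dy; have [|z dz] := aC i (x - y); last by exists z.
by rewrite (linD _ _ (@cpx_dL _ C _)) (linN _ (@cpx_dL _ C _)) dx dy subr0.
Qed.

Lemma quasi_iso_acyclic C D (f : cpx_map C D) :
  acyclic C -> acyclic D -> quasi_iso f.
Proof.
move=> aC aD i; split=> [x y dx dy _|y dy]; first exact: acyclic_homologous.
exists 0; first exact: lin0 (@cpx_dL _ C _).
by apply: acyclic_homologous => //; rewrite cpx_map0 (lin0 (@cpx_dL _ D _)).
Qed.

Definition zero_complex : complex R.
Proof.
refine (@Complex R (fun=> 'rV[R]_0) (fun _ _ => 0) _ _).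
- by move=> i c x y; rewrite scaler0 addr0.
- by [].
Defined.

Lemma zero_complexE i (x y : zero_complex i) : x = y.
Proof. by rewrite (thinmx0 x) (thinmx0 y). Qed.

Lemma acyclic_zero : acyclic zero_complex.
Proof. by move=> i x _; exists 0; apply: zero_complexE. Qed.

Definition to_zero C : cpx_map C zero_complex.
Proof.
refine (@CpxMap R C zero_complex (fun _ _ => 0) _ _).
- by move=> i c x y; apply: zero_complexE.
- by move=> i x; apply: zero_complexE.
Defined.

Definition zero_dga : dga R.
Proof.
refine (@Dga R zero_complex 0 (fun _ _ _ _ _ _ => 0) _ _ _ _ _ _).
- by move=> i j k e b c x y; apply: zero_complexE.
- by move=> i j k e b c x y; apply: zero_complexE.
all: by move=> *; apply: zero_complexE.
Defined.

Definition to_zero_dga (A : dga R) : dga_hom A zero_dga.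
Proof.
by refine (@DgaHom R A zero_dga (to_zero A) _ _) => *; apply: zero_complexE.
Defined.

Definition dga_one_boundary (A : dga R) : Prop :=
  exists z : A 1, cpx_d A z = dga_one A.

Lemma dga_d1 (A : dga R) : cpx_d A (dga_one A) = 0.
Proof.
have e1 : 0 - 1 + 0 = 0 - 1 :> int by rewrite addr0.
have e2 : 0 + (0 - 1) = 0 - 1 :> int by rewrite add0r.
have := dga_leibniz (addr0 0) e1 e2 (dga_one A) (dga_one A).
by rewrite !dga_mula1 dga_mul1a ksign0z => /eqP; rewrite -subr_eq subrr eq_sym => /eqP.
Qed.

(** If d z = 1 and d x = 0, then d (z x) = x. *)
Lemma dgmod_acyclic (A : dga R) (M : dgmod A) : dga_one_boundary A -> acyclic M.
Proof.
case=> z dz i x dx; have e : 1 + (i - 1) = i by rewrite addrC subrK.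
have e1 : 1 - 1 + (i - 1) = i - 1 by rewrite subrr add0r.
have e2 : 1 + (i - 1 - 1) = i - 1 by rewrite addrC subrK.
exists (dgm_act M e z x); rewrite (dgm_leibniz e e1 e2) dx.
rewrite (lin0 (dgm_actLr e2 z)) ksign0 addr0 dz; exact: dgm_act1.
Qed.

Definition regular_dgmod (A : dga R) : dgmod A.
Proof.
refine (@Dgmod R A A (@dga_mul R A) _ _ _ _ _).
- exact: dga_mulLl.
- exact: dga_mulLr.
- exact: dga_mulA.
- exact: dga_mul1a.
- exact: dga_leibniz.
Defined.

Lemma dga_acyclic (A : dga R) : dga_one_boundary A -> acyclic A.
Proof. exact: (@dgmod_acyclic A (regular_dgmod A)). Qed.

Lemma quasi_isomorphic_one_boundary (A B : dga R) :
  quasi_isomorphic A B -> dga_one_boundary A -> dga_one_boundary B.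
Proof.
move=> AB uA; elim: AB => // {}B C f _ [z dz] fq.
  by exists (cpx_fun f z); rewrite -cpx_fun_d dz dga_fun1.
have [|| |w dw] := (fq 1).1 (dga_one C) (0 : C 0).
- exact: dga_d1.
- exact: lin0 (@cpx_dL _ C 0).
- by exists z; rewrite dz cpx_map0 subr0 dga_fun1.
by exists w; rewrite -dw subr0.
Qed.

Lemma quasi_isomorphic_of_one_boundary (A B : dga R) :
  dga_one_boundary A -> dga_one_boundary B -> quasi_isomorphic A B.
Proof.
move=> /dga_acyclic aA /dga_acyclic aB.
apply: (qi_backward (f := to_zero_dga B)).
  apply: (qi_forward (f := to_zero_dga A)) (qi_refl A) _.
  exact: quasi_iso_acyclic acyclic_zero.
exact: quasi_iso_acyclic acyclic_zero.
Qed.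

Lemma semifree_dga_one_boundary (S : semifree R) u :
  u \in homog R (sf_deg S) 1 -> sf_d S u = 1 ->
  dga_one_boundary (dga_of_semifree S).
Proof. by move=> hu du; exists (HComp hu); apply: val_inj. Qed.

Lemma dga_semifree_one_boundary (S : semifree R) :
  dga_one_boundary (dga_of_semifree S) -> one_boundary S.
Proof. by case=> z /(congr1 val) dz; exists (hval z). Qed.

End Homology.

(** * Derived categories *)
(** For a derived category this says that it is zero; unlike that statement, it does
not mention a zero object and passes through equivalences at once. *)
Definition parallel_equal (C : category) : Prop :=
  forall (X Y : C) (f g : mor X Y), meq f g.

(** A morphism of D is recovered from its image in C through the counit. *)
Lemma parallel_equal_equivalence (C D : tricat) :
  tri_equivalence C D -> parallel_equal C -> parallel_equal D.
Proof.
move=> E pC X Y f g; set F := te_fun E; set G := te_inv E.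
have [eps eps' epsK eps_nat] := te_counit E.
have recover h : meq h (mcomp (mcomp (eps Y) (fmap F (fmap G h))) (eps' X)).
  apply: meq_sym; apply: meq_trans (meq_comp (eps_nat X Y h) (meq_refl _)) _.
  apply: meq_trans (meq_sym (mcompA _ _ _)) _.
  by apply: meq_trans (meq_comp (meq_refl _) (epsK X).2) (mcompm1 _).
apply: meq_trans (recover f) (meq_sym _); apply: meq_trans (recover g) _.
apply: meq_comp (meq_refl _); apply: meq_comp (meq_refl _) _.
exact: fmap_eq (pC _ _ _ _).
Qed.

Section Derived.
Variables (R : comNzRingType) (A : dga R).
Local Notation mod := (dgmod A).

Section HomologyRelation.
Variable i : int.

(** The action on homology of degree i - 1 of a formal composite of DG maps and inverses
of quasi-isomorphisms. It is a relation between cycles, as an inverse does not lift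
to a map of cycles. *)
Fixpoint homology_rel (X Y : mod) (f : dmor X Y) : X (i - 1) -> Y (i - 1) -> Prop :=
  match f in dmor X Y return X (i - 1) -> Y (i - 1) -> Prop with
  | dmap _ _ f => fun x y =>
      [/\ cpx_d _ x = 0, cpx_d _ y = 0 & homologous (cpx_fun f x) y]
  | @dinv _ _ _ _ s _ => fun y x =>
      [/\ cpx_d _ x = 0, cpx_d _ y = 0 & homologous (cpx_fun s x) y]
  | dcomp _ _ _ g f => fun x z => exists2 y, homology_rel f x y & homology_rel g y z
  end.

Lemma homology_rel_cycle X Y (f : dmor X Y) x y :
  homology_rel f x y -> cpx_d X x = 0 /\ cpx_d Y y = 0.
Proof.
elim: f x y => {X Y} [X Y f|X Y s qs|X Y Z g IHg f IHf] x y /=; try by case.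
by case=> z /IHf[dx _] /IHg[_ dy].
Qed.

Lemma homology_rel_homologous X Y (f : dmor X Y) x x' y y' :
  cpx_d X x' = 0 -> cpx_d Y y' = 0 -> homologous x x' -> homologous y y' ->
  homology_rel f x y -> homology_rel f x' y'.
Proof.
elim: f x x' y y' => {X Y} [X Y f|X Y s qs|X Y Z g IHg f IHf] x x' y y' /=.
- move=> dx' dy' xx' yy' [dx dy h]; split=> //; apply: homologous_trans yy'.
  by apply: homologous_trans h; apply/homologous_map/homologous_sym.
- move=> dx' dy' xx' yy' [dx dy h]; split=> //; apply: homologous_trans xx'.
  by apply: homologous_trans h; apply/homologous_map/homologous_sym.
- move=> dx' dy' xx' yy' [z hf hg]; have [_ dz] := homology_rel_cycle hf.
  exists z; first exact: IHf (homologous_refl z) hf.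
  exact: IHg (homologous_refl z) yy' hg.
Qed.

Lemma homology_rel_eq X Y (f g : dmor X Y) : deq f g ->
  forall x y, homology_rel f x y <-> homology_rel g x y.
Proof.
elim=> {X Y f g} //=.
- by move=> X Y f g _ IH x y; split=> /IH.
- by move=> X Y f g h _ IH1 _ IH2 x y; split=> [/IH1/IH2|/IH2/IH1].
- move=> X Y Z g g' f f' _ IHg _ IHf x z.
  by split=> -[y /IHf hf /IHg hg]; exists y.
- move=> X Y Z W h g f x w; split.
    by case=> z [y hf hg] hh; exists y => //; exists z.
  by case=> y hf [z hg hh]; exists z => //; exists y.
- move=> X Y f x y; split=> [[z hf [dz dy zy]]|hf].
    have dx := (homology_rel_cycle hf).1.
    exact: homology_rel_homologous dx dy (homologous_refl _) zy hf.
  exists y => //; have [_ dy] := homology_rel_cycle hf.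
  by split=> //; apply: homologous_refl.
- move=> X Y f x y; split=> [[z [dx dz xz] hf]|hf].
    exact: homology_rel_homologous dx (homology_rel_cycle hf).2 (homologous_sym xz)
      (homologous_refl _) hf.
  exists x => //; have [dx _] := homology_rel_cycle hf.
  by split=> //; apply: homologous_refl.
- by move=> X Y f g fg x y; rewrite fg.
- move=> X Y Z g f x z; split=> [[dx dz h]|[y [dx dy xy] [_ dz yz]]].
    have dy := cpx_fun_cycle f dx.
    by exists (cpx_fun f x); split=> //; apply: homologous_refl.
  by split=> //; apply: homologous_trans yz; apply: homologous_map.
- move=> X Y s qs x x'; split=> [[y [dx dy xy] [dx' _ x'y]]|[dx dx' xx']].
    split=> //; apply: (qs i).1 => //.
    exact: homologous_trans xy (homologous_sym x'y).
  have dy := cpx_fun_cycle s dx.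
  exists (cpx_fun s x); split=> //; first exact: homologous_refl.
  exact/homologous_map/homologous_sym.
- move=> X Y s qs y y'; split=> [[x [dx dy xy] [_ dy' xy']]|[dy dy' yy']].
    by split=> //; apply: homologous_trans (homologous_sym xy) xy'.
  have [x dx xy] := (qs i).2 y dy.
  by exists x; split=> //; apply: homologous_trans xy yy'.
Qed.

End HomologyRelation.

Definition cpx_zero_map (C D : complex R) : cpx_map C D.
Proof.
refine (@CpxMap R C D (fun _ _ => 0) _ _).
- by move=> i c x y; rewrite scaler0 addr0.
- by move=> i x; rewrite (lin0 (@cpx_dL _ D i)).
Defined.

Definition zero_map (X Y : mod) : dgm_hom X Y.
Proof.
refine (@DgmHom R A X Y (cpx_zero_map X Y) _) => i j k e a x.
by rewrite /= (lin0 (dgm_actLr e a)).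
Defined.

(** If the identity and the zero map of the module A are equal in D(A), then they agree
on the homology class of 1. *)
Lemma parallel_equal_one_boundary :
  parallel_equal (derived_category A) -> dga_one_boundary A.
Proof.
move=> pA; pose M := regular_dgmod A.
have h : @homology_rel 1 M M (dmap (dgm_id M)) (dga_one A) (dga_one A).
  by split; [exact: dga_d1 | exact: dga_d1 | exact: homologous_refl].
have eq0 := pA M M (dmap (dgm_id M)) (dmap (zero_map M M)).
have [_ _ [z dz]] := (homology_rel_eq (i := 1) eq0 _ _).1 h.
exists (- z : A 1); rewrite (linN _ (@cpx_dL _ A 1)).
have -> : cpx_d A (z : A 1) = - dga_one A by rewrite -[LHS]dz; apply: sub0r.
by rewrite opprK.
Qed.

Definition zero_dgmod : mod.
Proof.
refine (@Dgmod R A (zero_complex R) (fun _ _ _ _ _ _ => 0) _ _ _ _ _).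
- by move=> i j k e b c x y; apply: zero_complexE.
- by move=> i j k e b c x y; apply: zero_complexE.
all: by move=> *; apply: zero_complexE.
Defined.

Definition to_zero_mod (X : mod) : dgm_hom X zero_dgmod.
Proof.
by refine (@DgmHom R A X zero_dgmod (to_zero X) _) => *; apply: zero_complexE.
Defined.

Hypothesis unitA : dga_one_boundary A.

Lemma acyclic_quasi_iso (X Y : mod) (f : dgm_hom X Y) : quasi_iso f.
Proof. by apply: quasi_iso_acyclic; apply: dgmod_acyclic. Qed.

Let p X := dmap (to_zero_mod X).
Let p' X := dinv (acyclic_quasi_iso (to_zero_mod X)).

(** All modules are acyclic, so X -> 0 is invertible in D(A) and every morphism X -> Y
is the composite of X -> 0 with the inverse of Y -> 0. *)
Lemma one_boundary_dmor (X Y : mod) (f : dmor X Y) : deq f (dcomp (p' Y) (p X)).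
Proof.
have left_inv Z W (h : dmor W Z) : deq h (dcomp (p' Z) (dcomp (p Z) h)).
  apply: deq_trans (deq_sym (deq_comp1m h)) _.
  have inv := deq_sym (deq_invl (acyclic_quasi_iso (to_zero_mod Z))).
  exact: deq_trans (deq_comp inv (deq_refl h)) (deq_sym (deq_compA _ _ _)).
have map_p Z W (h : dgm_hom Z W) : deq (dcomp (p W) (dmap h)) (p Z).
  apply: deq_trans (deq_sym (deq_map_comp _ _)) _.
  by apply: deq_map => i x; apply: zero_complexE.
elim: f => {X Y} [X Y f|X Y s qs|X Y Z g IHg f IHf].
- apply: deq_trans (left_inv _ _ _) _; apply: deq_comp (deq_refl _) _.
  exact: map_p.
- apply: deq_trans (left_inv _ _ _) _; apply: deq_comp (deq_refl _) _.
  apply: deq_trans (deq_comp (deq_sym (map_p _ _ s)) (deq_refl _)) _.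
  apply: deq_trans (deq_sym (deq_compA _ _ _)) _.
  apply: deq_trans (deq_comp (deq_refl _) (deq_invr _)) (deq_compm1 _).
- apply: deq_trans (deq_comp IHg IHf) _.
  apply: deq_trans (deq_sym (deq_compA _ _ _)) (deq_comp (deq_refl _) _).
  apply: deq_trans (deq_compA _ _ _) _.
  apply: deq_trans (deq_comp (deq_invr _) (deq_refl _)) (deq_comp1m _).
Qed.

Lemma one_boundary_parallel_equal : parallel_equal (derived_category A).
Proof.
move=> X Y f g.
exact: deq_trans (one_boundary_dmor f) (deq_sym (one_boundary_dmor g)).
Qed.

End Derived.

Section ZeroEquivalence.
Variables (R : comNzRingType).

Definition zero_functor (A B : dga R) :
  functor (derived_category A) (derived_category B) :=
  @Functor (derived_category A) (derived_category B) (fun=> zero_dgmod B)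
    (fun _ _ _ => idm (zero_dgmod B : derived_category B))
    (fun _ _ _ _ _ => meq_refl _) (fun _ => meq_refl _)
    (fun _ _ _ _ _ => meq_sym (mcomp1m _)).

Variable A : dga R.
Hypothesis unitA : dga_one_boundary A.

Definition parallel_natural_iso (C : category) (F G : functor C (derived_category A)) :
  natural_iso F G :=
  @NaturalIso C (derived_category A) F G (fun X => dmap (zero_map (F X) (G X)))
   (fun X => dmap (zero_map (G X) (F X)))
   (fun X => conj (one_boundary_parallel_equal unitA _ _)
                  (one_boundary_parallel_equal unitA _ _))
   (fun X Y f => one_boundary_parallel_equal unitA _ _).

Lemma one_boundary_iso X Y (f : @mor (derived_cat A) X Y) : is_iso f.
Proof.
by exists (dmap (zero_map Y X)); split; apply: (one_boundary_parallel_equal unitA).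
Qed.

Lemma one_boundary_dadd X Y (f g h : @mor (derived_cat A) X Y) : dadd f g h.
Proof.
by exists (dmap (zero_map _ _)); split; apply: (one_boundary_parallel_equal unitA).
Qed.

Lemma one_boundary_ddist X Y Z (u : @mor (derived_cat A) X Y)
  (v : @mor (derived_cat A) Y Z) w : ddist u v w.
Proof.
pose O := zero_dgmod A; exists O, O, (zero_map O O).
exists (dmap (zero_map _ _)), (dmap (zero_map _ _)), (dmap (zero_map _ _)).
by split; split; try apply: one_boundary_iso;
  apply: (one_boundary_parallel_equal unitA).
Qed.

End ZeroEquivalence.

Lemma derived_Morita_of_one_boundary (R : comNzRingType) (A B : dga R) :
  dga_one_boundary A -> dga_one_boundary B -> derived_Morita_equivalent A B.
Proof.
move=> uA uB; constructor.
apply: (@TriEquivalence (derived_category A) (derived_category B)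
  (zero_functor A B) (zero_functor B A) (parallel_natural_iso uA _ _)
  (parallel_natural_iso uB _ _) _ (parallel_natural_iso uB _ _)).
- by move=> X Y f g h _; apply: one_boundary_dadd.
- by move=> X Y Z u v w _; apply: one_boundary_ddist.
Qed.

Lemma derived_Morita_one_boundary (R : comNzRingType) (A B : dga R) :
  derived_Morita_equivalent A B -> dga_one_boundary A -> dga_one_boundary B.
Proof.
case=> E uA; apply: parallel_equal_one_boundary.
exact: parallel_equal_equivalence E (one_boundary_parallel_equal uA).
Qed.

(** * DGAs of presentations of monoids with zero *)
Lemma linB (R : comNzRingType) (U V : lmodType R) (f : U -> V) x y :
  linear f -> f (x - y) = f x - f y.
Proof. by move=> fL; rewrite (linD _ _ fL) (linN _ fL). Qed.

Section Context.
Variables (R : comNzRingType) (A : lalgType R).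

Lemma mulB_context (x u v y : A) : x * (u - v) * y = x * (u * y) - x * (v * y).
Proof. by rewrite mulrBr mulrBl !mulrA. Qed.

Lemma mulB_mid (x u v y : A) : x * (u - v) * y = x * u * y - x * v * y.
Proof. by rewrite mulrBr mulrBl. Qed.

Lemma mul_der_step (x r y g e : A) i :
  x * (r * y + ksign i (g * e)) = x * r * y + ksign i (x * g * e).
Proof. by rewrite mulrDr ksign_mulr !mulrA. Qed.

Lemma leibniz_context (d : A -> A) i x r y z :
  leibniz_at d i (x * r) y -> leibniz_at d 0 x r ->
  d x = 0 -> d y = 0 -> d r = z -> d (x * r * y) = x * z * y.
Proof.
rewrite /leibniz_at => -> -> -> -> ->.
by rewrite mulr0 mul0r ksign0 addr0 add0r ksign0z.
Qed.

End Context.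

Section Presentation.
Variables (R : comNzRingType) (L J : finType).
Local Notation G := (L + J)%type.
Local Notation T := (tensor_alg R G).

(** (u, Some v) stands for u = v, and (u, None) for u = 0. *)
Definition relation : Type := seq L * option (seq L).

Definition pres_deg (z : G) : int := if z is inr _ then 1 else 0.

Definition letters (m : seq L) : T := gword R [seq (inl a : G) | a <- m].

Definition rel_poly (r : relation) : T :=
  if r.2 is Some v then letters r.1 - letters v else letters r.1.

Definition is_letter : {pred G} := fun z => if z is inl _ then true else false.

Lemma letters_nil : letters [::] = 1.
Proof. exact: gword_nil. Qed.

Lemma letters_cat m1 m2 : letters (m1 ++ m2) = letters m1 * letters m2.
Proof. by rewrite /letters map_cat gword_cat. Qed.

Lemma letters_homog m : letters m \in homog R pres_deg 0.
Proof. by apply: homog_gword; rewrite /seq_degree big_map big1. Qed.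

Lemma letters_supp m : letters m \in word_supp is_letter.
Proof. by apply: word_supp_gword; apply/allP => z /mapP[a _ ->]. Qed.

Lemma rel_poly_homog r : rel_poly r \in homog R pres_deg 0.
Proof.
rewrite /rel_poly; case: r.2 => [v|]; last exact: letters_homog.
by apply: rpredB; apply: letters_homog.
Qed.

Lemma rel_poly_supp r : rel_poly r \in word_supp is_letter.
Proof.
rewrite /rel_poly; case: r.2 => [v|]; last exact: letters_supp.
rewrite -[_ - _]/(_ + _) addrC -scaleN1r.
by apply: word_suppDZ; apply: letters_supp.
Qed.

Variable rel : J -> relation.

Definition pres_d (z : G) : T := if z is inr j then rel_poly (rel j) else 0.

Lemma der_letters m : der pres_deg pres_d (letters m) = 0.
Proof.
rewrite der_gword; elim: m => //= a m ->.
by rewrite mul0r mulr0 ksign0 addr0.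
Qed.

Fact pres_d_homog z : pres_d z \in homog R pres_deg (pres_deg z - 1).
Proof. case: z => [a|j]; [exact: rpred0 | exact: rel_poly_homog]. Qed.

Fact pres_d_closed z : der pres_deg pres_d (pres_d z) = 0.
Proof.
have dL := der_linear pres_deg pres_d.
case: z => [a|j] /=; first exact: der0.
rewrite /rel_poly; case: (rel j).2 => [v|]; last exact: der_letters.
by rewrite (linD _ _ dL) (linN _ dL) !der_letters subr0.
Qed.

Definition presentation : semifree R := free_dga pres_d_homog pres_d_closed.

(** Bounding chains are required to be homogeneous: as elements of the graded
pieces of the associated DGA they have to be. *)
Definition boundary (p : T) : Prop :=
  exists2 u, u \in homog R pres_deg 1 & der pres_deg pres_d u = p.

Lemma boundary0 : boundary 0.
Proof. by exists 0; [exact: rpred0 | exact: der0]. Qed.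

Lemma boundaryD p q : boundary p -> boundary q -> boundary (p + q).
Proof.
move=> [u uh du] [v vh dv]; exists (u + v); first exact: rpredD.
by rewrite (linD _ _ (der_linear _ _)) du dv.
Qed.

Lemma boundaryN p : boundary p -> boundary (- p).
Proof.
move=> [u uh du]; exists (- u); first by rewrite rpredN.
by rewrite (linN _ (der_linear _ _)) du.
Qed.

(** The bounding chain is x r y, where r is the generator of the relation. *)
Lemma boundary_context x y j : boundary (letters x * rel_poly (rel j) * letters y).
Proof.
have jh : gvar R (inr j : G) \in homog R pres_deg 1.
  exact: (homog_gvar R pres_deg (inr j)).
have xjh : letters x * gvar R (inr j : G) \in homog R pres_deg 1.
  exact: homog_mul (add0r _) (letters_homog x) jh.
exists (letters x * gvar R (inr j : G) * letters y).
  exact: homog_mul (addr0 _) xjh (letters_homog y).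
apply: leibniz_context (der_leibniz _ _ xjh) (der_leibniz _ _ _) _ _ _.
- exact: letters_homog.
- exact: der_letters.
- exact: der_letters.
- exact: der_gvar.
Qed.

Definition word_eq (x y : seq L) : Prop := boundary (letters x - letters y).

Lemma word_eq_refl x : word_eq x x.
Proof. by rewrite /word_eq subrr; apply: boundary0. Qed.

Lemma word_eq_sym x y : word_eq x y -> word_eq y x.
Proof. by move=> xy; have := boundaryN xy; rewrite opprB. Qed.

Lemma word_eq_trans x y z : word_eq x y -> word_eq y z -> word_eq x z.
Proof. by move=> xy yz; have := boundaryD xy yz; rewrite addrA subrK. Qed.

Lemma word_eq_rel x u v y j : rel j = (u, Some v) ->
  word_eq (x ++ u ++ y) (x ++ v ++ y).
Proof.
move=> relj; have := boundary_context x y j.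
by rewrite relj /word_eq !letters_cat /rel_poly mulB_context.
Qed.

Lemma word_boundary_rel x u y j : rel j = (u, None) -> boundary (letters (x ++ u ++ y)).
Proof.
move=> relj; have := boundary_context x y j.
by rewrite relj /rel_poly !letters_cat mulrA.
Qed.

Lemma word_eq_boundary x y :
  word_eq x y -> boundary (letters x) -> boundary (letters y).
Proof.
by move=> xy bx; have := boundaryD bx (boundaryN xy); rewrite opprB addrC subrK.
Qed.

(** A union Phi of congruence classes that avoids 0 gives a linear functional, the
indicator of Phi on words in the letters, extended by 0 to words containing
relators. It kills every boundary: the differential of a word is a combination of
the words obtained by replacing one relator by u - v. *)
Section Functional.
Variable Phi : pred (seq L).
Hypothesis Phi_rel : forall x j y, Phi (x ++ (rel j).1 ++ y) =
  if (rel j).2 is Some v then Phi (x ++ v ++ y) else false.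

Definition letter_of (z : G) : option L := if z is inl a then Some a else None.

Definition word_value (m : seq G) : R :=
  (all is_letter m && Phi (pmap letter_of m))%:R.

Definition functional : T -> R^o := lin_ext (word_value : seq G -> R^o).

Lemma functional_linear : linear functional. Proof. exact: lin_ext_linear. Qed.

Lemma functional_rel x y j : functional (gword R x * rel_poly (rel j) * gword R y) = 0.
Proof.
have value u : functional (gword R x * letters u * gword R y) =
    (all is_letter x && all is_letter y &&
     Phi (pmap letter_of x ++ u ++ pmap letter_of y))%:R.
  rewrite /letters -!gword_cat [LHS]lin_ext_gword /word_value !all_cat !pmap_cat.
  have -> : all is_letter [seq (inl a : G) | a <- u] by apply/allP => z /mapP[a _ ->].
  have -> : pmap letter_of [seq (inl a : G) | a <- u] = u.
    by rewrite map_pK.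
  by rewrite andbT -catA.
have := Phi_rel (pmap letter_of x) j (pmap letter_of y); rewrite /rel_poly.
case: (rel j).2 => [v|] E; last by rewrite value E andbF.
rewrite mulB_mid.
apply: etrans (linB _ _ functional_linear) _.
apply: etrans (congr2 (fun a b => a - b) (value _) (value _)) _.
by rewrite E subrr.
Qed.

Lemma functional_der p : functional (der pres_deg pres_d p) = 0.
Proof.
apply: (linear_eq_gword (f := fun p => functional (der pres_deg pres_d p))
  (g := fun=> 0)).
- exact: linear_comp functional_linear (der_linear _ _).
- by move=> c a b; rewrite scaler0 addr0.
move=> m; rewrite der_gword -[der_word _ _ m]mul1r -(gword_nil R G).
(* the prefix x collects the generators already passed *)
elim: m [::] => [|z m IH] x; first by rewrite mulr0 (lin0 functional_linear).
have step := mul_der_step (gword R x) (pres_d z) (gword R m) (gvar R z)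
  (der_word pres_deg pres_d m) (pres_deg z).
apply: etrans (congr1 functional step) _.
apply: etrans (linD _ _ functional_linear) _.
rewrite [functional (ksign _ _)](lin_ksign _ _ functional_linear).
have -> : gword R x * gvar R z = gword R (x ++ [:: z]) by rewrite gword_cat gword1.
apply: etrans (congr1 (fun r => _ + ksign _ r) (IH _)) _; rewrite ksign0 addr0.
case: z {step} => [a|j]; last exact: functional_rel.
by rewrite /pres_d mulr0 mul0r (lin0 functional_linear).
Qed.

Lemma not_one_boundary : Phi [::] -> ~ one_boundary presentation.
Proof.
move=> Phi1 [u du]; have := functional_der u.
rewrite -[der _ _ u]/(sf_d presentation u) du -gword_nil [functional _]lin_ext_gword.
by rewrite /word_value /= Phi1 => /eqP; rewrite oner_eq0.
Qed.

End Functional.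

Section Coding.
Variables (rep : seq bool -> R -> Prop) (w1 wN1 : seq bool).
Hypotheses (rep1 : rep w1 1) (repN1 : rep wN1 (-1)).
Variables (ls : seq L) (js : seq J).
Hypotheses (ls_uniq : uniq ls) (ls_all : ls =i L).
Hypotheses (js_uniq : uniq js) (js_all : js =i J).

Definition gens : seq G := [seq inl a | a <- ls] ++ [seq inr j | j <- js].

Definition word_code (m : seq L) : seq nat := [seq index a ls | a <- m].

(** The left-hand side comes last: for the last relation of [sys_rel], only the end
of the code then depends on the start word. *)
Definition rel_code (r : relation) : poly_code :=
  if r.2 is Some v then [:: (wN1, word_code v); (w1, word_code r.1)]
  else [:: (w1, word_code r.1)].

Definition gen_code (z : G) : int * poly_code :=
  if z is inr j then (1, rel_code (rel j)) else (0, [::]).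

Definition pres_code : semifree_code := [seq gen_code z | z <- gens].

Lemma gens_uniq : uniq gens.
Proof.
rewrite cat_uniq !map_inj_uniq ?ls_uniq ?js_uniq ?andbT /=; try by move=> ? ? [].
by apply/hasPn => z /mapP[j _ ->]; apply/mapP => -[].
Qed.

Lemma gens_all z : z \in gens.
Proof.
rewrite mem_cat; apply/orP; case: z => [a|j].
  by left; rewrite map_f // ls_all.
by right; rewrite map_f // js_all.
Qed.

Definition gen_at (i : 'I_(size pres_code)) : G :=
  tnth (in_tuple gens) (cast_ord (size_map gen_code gens) i).

Fact gen_index_lt z : (index z gens < size pres_code)%N.
Proof. by rewrite size_map index_mem gens_all. Qed.

Definition gen_index z : 'I_(size pres_code) := Ordinal (gen_index_lt z).

Lemma gen_indexK : cancel gen_index gen_at.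
Proof. by move=> z; rewrite /gen_at (tnth_nth z) /= nth_index ?gens_all. Qed.

Lemma gen_atK : cancel gen_at gen_index.
Proof.
move=> i; apply: val_inj; rewrite /gen_at /= (tnth_nth (gen_at i)) /=.
by rewrite index_uniq ?gens_uniq //= -(size_map gen_code).
Qed.

Lemma index_letter a : index (inl a : G) gens = index a ls.
Proof.
by rewrite index_cat map_f ?ls_all // index_map // => ? ? [].
Qed.

Lemma poly_codes_word w c m s p : rep w c -> poly_codes rep gen_at s p ->
  poly_codes rep gen_at ((w, word_code m) :: s) (c *: letters m + p).
Proof.
move=> wc sp.
have -> : word_code m = [seq val i | i <- [seq gen_index (inl a) | a <- m]].
  by rewrite -map_comp; apply: eq_map => a /=; rewrite index_letter.
have -> : letters m = \prod_(i <- [seq gen_index (inl a) | a <- m]) gvar R (gen_at i).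
  rewrite big_map /letters -gword_prod big_map.
  by apply: eq_bigr => a _; rewrite gen_indexK.
exact: poly_codesD.
Qed.

Lemma pres_codesP : semifree_codes rep pres_code presentation.
Proof.
exists gen_at; split; first by exists gen_index; [exact: gen_atK | exact: gen_indexK].
move=> i.
have -> : tnth (in_tuple pres_code) i = gen_code (gen_at i).
  rewrite (tnth_nth (gen_code (gen_at i))) /gen_at /= (tnth_nth (gen_at i)) /=.
  by rewrite (nth_map (gen_at i)) // -(size_map gen_code).
change (pres_deg (gen_at i) = (gen_code (gen_at i)).1 /\ poly_codes rep gen_at
  (gen_code (gen_at i)).2 (der pres_deg pres_d (gvar R (gen_at i)))).
rewrite der_gvar; case: (gen_at i) => [a|j] /=; split=> //; first exact: poly_codes0.
rewrite /rel_poly /rel_code; case: (rel j) => u [v|] /=.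
  have -> : letters u - letters v = -1 *: letters v + (1 *: letters u + 0).
    by rewrite scaleN1r scale1r addr0 addrC.
  by do 2 apply: poly_codes_word => //; apply: poly_codes0.
have -> : letters u = 1 *: letters u + 0 by rewrite scale1r addr0.
by apply: poly_codes_word => //; apply: poly_codes0.
Qed.

End Coding.

End Presentation.

Lemma presentation_stable_tame (R : comNzRingType) (L J : finType)
    (rel rel' : J -> relation L) :
    boundary rel (1 : tensor_alg R (L + J)%type) ->
    boundary rel' (1 : tensor_alg R (L + J)%type) ->
  stable_tame_isomorphic (presentation R rel) (presentation R rel').
Proof.
move=> b b'; apply: (@stable_tame_of_one_boundary R _ _ (@is_letter L J)) b b'.
- by case.
- by case=> [a|j]; [exact: word_supp0 | exact: rel_poly_supp].
- by case.
- by case=> [a|j]; [exact: word_supp0 | exact: rel_poly_supp].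
Qed.

Local Close Scope ring_scope.
Local Close Scope fset_scope.

(** * Rewriting systems with a head *)
Section WindowSystem.
Variables K H : finType.
Local Notation letter := (K + H)%type.
Local Notation word := (seq letter).

Definition cfg (l : seq K) (h : H) (r : seq K) : word :=
  [seq inl a | a <- l] ++ inr h :: [seq inl a | a <- r].

(** What happens at a window a h c: it is rewritten to another word with one head, or it
is 0, or it is left alone. *)
Inductive verdict := Go of seq K & H & seq K | Kill | Stop.

Variable delta : K -> H -> K -> verdict.

Definition window a h c : word := cfg [:: a] h [:: c].

Inductive step : word -> word -> Prop :=
  Step x y a h c l h' r : delta a h c = Go l h' r ->
    step (x ++ window a h c ++ y) (x ++ cfg l h' r ++ y).

Inductive steps : word -> word -> Prop :=
| steps_refl g : steps g g
| steps_step g g' g'' : step g g' -> steps g' g'' -> steps g g''.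

Lemma steps_trans g g' g'' : steps g g' -> steps g' g'' -> steps g g''.
Proof. by elim=> // {}g {}g' g1 st _ IH /IH; apply: steps_step. Qed.

Lemma cfg_window l a h c r : cfg (rcons l a) h (c :: r) =
  [seq inl k | k <- l] ++ window a h c ++ [seq inl k | k <- r].
Proof. by rewrite /window /cfg map_rcons -cats1 -!catA. Qed.

Lemma step_cfg l a h c r vl h' vr : delta a h c = Go vl h' vr ->
  step (cfg (rcons l a) h (c :: r)) (cfg (l ++ vl) h' (vr ++ r)).
Proof.
move=> e; have := Step [seq inl a | a <- l] [seq inl a | a <- r] e.
by rewrite /window /cfg /= map_rcons -cats1 !map_cat -!catA.
Qed.

Definition is_head (x : letter) : bool := if x is inr _ then true else false.

Lemma heads_inl (l : seq K) : count is_head [seq inl a | a <- l] = 0.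
Proof. by elim: l. Qed.

Lemma heads_cfg l h r : count is_head (cfg l h r) = 1.
Proof. by rewrite /cfg count_cat /= !heads_inl. Qed.

(** The position of the only head determines the window: this is what makes rewriting
deterministic. *)
Lemma window_unique x a h c y x' a' h' c' y' :
  count is_head (x ++ window a h c ++ y) = 1 ->
  x ++ window a h c ++ y = x' ++ window a' h' c' ++ y' ->
  [/\ x = x', a = a', h = h', c = c' & y = y'].
Proof.
have pos z b k d t : count is_head (z ++ window b k d ++ t) = 1 ->
    find is_head (z ++ window b k d ++ t) = (size z).+1.
  rewrite count_cat find_cat has_count; case: (count is_head z) => [|n] /=.
    by rewrite addn1.
  by rewrite !add0n add1n addSn addnS.
move=> one e; have := pos _ _ _ _ _ one; rewrite e pos -?e // => -[sz].
by move/eqP: e; rewrite eqseq_cat // => /andP[/eqP-> /eqP[-> -> -> ->]].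
Qed.

Lemma step_heads g g' : step g g' -> count is_head g = count is_head g'.
Proof.
case=> x y a h c l h' r _.
by rewrite 2!(count_cat _ x) 2!(count_cat _ _ y) /window !heads_cfg.
Qed.

Lemma steps_heads g g' : steps g g' -> count is_head g = count is_head g'.
Proof. by elim=> // ? ? ? /step_heads-> _ ->. Qed.

Section Class.
Variables (l0 r0 : seq K) (a0 : K) (h0 : H) (c0 : K).
Hypothesis stop0 : delta a0 h0 c0 = Stop.

Definition final : word := cfg (rcons l0 a0) h0 (c0 :: r0).
Definition live (g : word) : Prop := steps g final.

(** A live word is either final, and then its window stops, or has a first step, which
has to be the one at this window. *)
Lemma live_window x a h c y : live (x ++ window a h c ++ y) ->
  if delta a h c is Go l h' r then live (x ++ cfg l h' r ++ y)
  else delta a h c = Stop.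
Proof.
move=> lg; have one := steps_heads lg; rewrite /final heads_cfg in one.
move: lg one; rewrite /live; move eqg: (x ++ _ ++ _) => g; move eqf: final => f lg one.
case: lg one eqg eqf => {g f} [g|g g1 f].
  move=> one eqg; rewrite /final cfg_window -eqg => eqf; rewrite -eqf in eqg.
  have [|_ <- <- <- _] := window_unique _ eqf; last by rewrite stop0.
  by rewrite eqg.
case=> x' y' a' h' c' l h1 r e st one eqg eqf.
rewrite -eqg in one; have [-> -> -> -> ->] := window_unique one eqg.
by rewrite e.
Qed.

Lemma live_go x a h c y l h' r : delta a h c = Go l h' r ->
  live (x ++ window a h c ++ y) <-> live (x ++ cfg l h' r ++ y).
Proof.
move=> e; split=> [/live_window|]; first by rewrite e.
exact/steps_step/Step.
Qed.

Lemma live_kill x a h c y : delta a h c = Kill -> ~ live (x ++ window a h c ++ y).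
Proof. by move=> e /live_window; rewrite e. Qed.

End Class.

Variable w0 : word.

Local Notation sym := (letter + bool)%type.
Definition opening : sym := inr false.
Definition closing : sym := inr true.
Definition inner (g : word) : seq sym := [seq inl x | x <- g].
Definition enclose (g : word) : seq sym := opening :: inner g ++ [:: closing].

(** A window that stops gives the trivial relation u = u. *)
Definition sys_rel (j : option (K * H * K)) : relation sym :=
  if j is Some (a, h, c) then
    (inner (window a h c),
     match delta a h c with
     | Go l h' r => Some (inner (cfg l h' r))
     | Kill => None
     | Stop => Some (inner (window a h c))
     end)
  else (enclose w0, Some [::]).

Section Positive.
Variable R : comNzRingType.
Local Notation boundary := (boundary (R := R) sys_rel).
Local Notation word_eq := (word_eq R sys_rel).

Lemma inner_cat g g' : inner (g ++ g') = inner g ++ inner g'.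
Proof. exact: map_cat. Qed.

Lemma enclose_cat x u y : enclose (x ++ u ++ y) =
  (opening :: inner x) ++ inner u ++ (inner y ++ [:: closing]).
Proof. by rewrite /enclose !inner_cat -!catA. Qed.

Lemma steps_word_eq g g' : steps g g' -> word_eq (enclose g) (enclose g').
Proof.
elim=> [{}g|{}g g1 {}g' [x y a h c l h' r e] _ IH]; first exact: word_eq_refl.
apply: word_eq_trans IH; rewrite !enclose_cat.
have := @word_eq_rel R _ _ sys_rel (opening :: inner x) (inner (window a h c))
  (inner (cfg l h' r)) (inner y ++ [:: closing]) (Some (a, h, c)).
by apply; rewrite /sys_rel e.
Qed.

(** 1 equals the bracketed start word, hence a word that contains a window equal
to 0. *)
Lemma kill_boundary l a h c r : delta a h c = Kill ->
  steps w0 (cfg (rcons l a) h (c :: r)) -> boundary 1.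
Proof.
rewrite cfg_window => e /steps_word_eq; move: (map _ l) (map _ r) => x y st.
rewrite -letters_nil.
have omega : word_eq (enclose w0) [::].
  have := @word_eq_rel R _ _ sys_rel [::] (enclose w0) [::] [::] None erefl.
  by rewrite /= cats0.
apply: word_eq_boundary omega _.
have := @word_boundary_rel R _ _ sys_rel (opening :: inner x)
  (inner (window a h c)) (inner y ++ [:: closing]) (Some (a, h, c)).
rewrite /sys_rel e -enclose_cat => /(_ erefl) b.
exact: word_eq_boundary (word_eq_sym st) b.
Qed.

End Positive.

(** Conversely, let G be a set of words closed under the rules in both directions, that
avoids 0 and contains the start word. As the relation [enclose w0] = 1 allows brackets
to be inserted anywhere, words are read by an automaton with a stack. Reading from
the right, a closing bracket pushes an empty word, a letter is added to the top
word, and an opening bracket pops the top word if it is in G. A word is accepted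
if it turns the empty stack into the empty stack. *)
Section Negative.
Variable R : comNzRingType.
Variable G : word -> Prop.
Hypothesis G_go : forall x a h c y l h' r, delta a h c = Go l h' r ->
  G (x ++ window a h c ++ y) <-> G (x ++ cfg l h' r ++ y).
Hypothesis G_kill : forall x a h c y, delta a h c = Kill ->
  ~ G (x ++ window a h c ++ y).
Hypothesis G_start : G w0.

Definition act (s : sym) (st : option (seq word)) : option (seq word) :=
  match s, st with
  | inl x, Some (t :: st') => Some ((x :: t) :: st')
  | inr true, Some st' => Some ([::] :: st')
  | inr false, Some (t :: st') => if `[< G t >] then Some st' else None
  | _, _ => None
  end.

Definition run (w : seq sym) (st : option (seq word)) := foldr act st w.

Definition accepted (w : seq sym) : bool := run w (Some [::]) == Some [::].

Lemma run_cat w w' st : run (w ++ w') st = run w (run w' st).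
Proof. exact: foldr_cat. Qed.

Lemma run_None w : run w None = None.
Proof. by elim: w => //= s w ->; case: s => [x|[]]. Qed.

Lemma run_inner g t st : run (inner g) (Some (t :: st)) = Some ((g ++ t) :: st).
Proof. by elim: g => //= x g ->. Qed.

Lemma run_inner_nil g : g != [::] -> run (inner g) (Some [::]) = None.
Proof.
case/lastP: g => // g x _; rewrite -cats1 inner_cat run_cat /=.
exact: run_None.
Qed.

(** Top words that cannot be told apart by what is still to be read on their left. *)
Definition indist (t t' : word) : Prop := forall p, G (p ++ t) <-> G (p ++ t').

Fixpoint indist_stack (st st' : seq word) : Prop :=
  match st, st' with
  | [::], [::] => True
  | t :: r, t' :: r' => indist t t' /\ indist_stack r r'
  | _, _ => False
  end.

Lemma indist_stack_refl st : indist_stack st st.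
Proof. by elim: st. Qed.

Lemma run_indist w st st' : indist_stack st st' ->
  (run w (Some st) == Some [::]) = (run w (Some st') == Some [::]).
Proof.
elim/last_ind: w st st' => [|w s IH] st st'; first by case: st st' => [|t r] [|t' r'].
move=> ss'; rewrite -cats1 !run_cat /=.
case: s => [x|[]] /=.
- case: st st' ss' => [|t r] [|t' r'] //= [tt' rr'].
  by apply: IH; split=> // p; have := tt' (rcons p x); rewrite !cat_rcons.
- by apply: IH; split.
- case: st st' ss' => [|t r] [|t' r'] //= [tt' rr'].
  have -> : `[< G t >] = `[< G t' >] by apply: asbool_equiv_eq; apply: (tt' [::]).
  by case: asboolP => _; [apply: IH | rewrite !run_None].
Qed.

(** A top word that cannot be completed to an element of G blocks the stack forever. *)
Lemma run_dead w st t : t \in st -> (forall p, ~ G (p ++ t)) ->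
  run w (Some st) != Some [::].
Proof.
elim/last_ind: w st t => [|w s IH] st t ts dead.
  by case: st ts.
rewrite -cats1 run_cat /=; case: s => [x|[]] /=.
- case: st ts => [|t' r] //; rewrite inE => /orP[/eqP E|tr].
    apply: (IH _ (x :: t')); first exact: mem_head.
    by move=> p; rewrite -cat_rcons -E; apply: dead.
  by apply: (IH _ t) => //; rewrite inE tr orbT.
- by apply: (IH _ t) => //; rewrite inE ts orbT.
- case: st ts => [|t' r] //; rewrite inE => /orP[/eqP E|tr].
    by case: asboolP => [|_]; [rewrite -E => /(dead [::]) | rewrite run_None].
  by case: asboolP => [_|_]; [apply: (IH _ t) | rewrite run_None].
Qed.

Lemma cfg_neq0 l h r : cfg l h r != [::].
Proof. by case: l. Qed.

Lemma accepted_rel x j y : accepted (x ++ (sys_rel j).1 ++ y) =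
  if (sys_rel j).2 is Some v then accepted (x ++ v ++ y) else false.
Proof.
rewrite /accepted; case: j => [[[a h] c]|]; last first.
  rewrite /= /enclose /= -catA /= run_cat [run (_ :: _) _]/= run_cat /=.
  rewrite [run (x ++ y) _]run_cat.
  case: (run y (Some [::])) => [st|]; last by rewrite run_None !run_None.
  by rewrite /= run_inner cats0 /= (asboolT G_start).
have -> : (sys_rel (Some (a, h, c))).1 = inner (window a h c) by [].
have -> : (sys_rel (Some (a, h, c))).2 = match delta a h c with
  | Go l h' r => Some (inner (cfg l h' r))
  | Kill => None
  | Stop => Some (inner (window a h c)) end by [].
rewrite !run_cat; case Ey: (run y (Some [::])) => [[|t st]|].
- rewrite run_inner_nil ?cfg_neq0 // run_None.
  case: (delta a h c) => [l h' r||] //; rewrite !run_cat Ey run_inner_nil ?cfg_neq0 //.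
    by rewrite run_None.
  by rewrite run_None.
- rewrite run_inner; case e: (delta a h c) => [l h' r||].
  + rewrite !run_cat Ey run_inner; apply: run_indist.
    split; last exact: indist_stack_refl.
    by move=> p; apply: G_go.
  + apply/negbTE/(run_dead _ (mem_head _ _)) => p; exact: G_kill.
  + by rewrite !run_cat Ey run_inner.
- rewrite !run_None; case: (delta a h c) => [l h' r||] //.
    by rewrite !run_cat Ey !run_None.
  by rewrite !run_cat Ey !run_None.
Qed.

Lemma live_not_one_boundary : ~ one_boundary (presentation R sys_rel).
Proof. by apply: (not_one_boundary (Phi := accepted)) => //; apply: accepted_rel. Qed.

End Negative.

(** G is the set of words that rewrite to the given stuck word. *)
Lemma stop_not_one_boundary (R : comNzRingType) l a h c r : delta a h c = Stop ->
  steps w0 (cfg (rcons l a) h (c :: r)) -> ~ one_boundary (presentation R sys_rel).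
Proof.
move=> e st; apply: (@live_not_one_boundary R (live l r a h c)) => //.
  by move=> x a' h' c' y l' h1 r'; apply: live_go.
by move=> x a' h' c' y; apply: live_kill.
Qed.
End WindowSystem.

(** * Turing machines as rewriting systems *)
Section Simulation.
Variable M : turing_machine.
(* the substitution h and the constant end t of the input of M *)
Variables (code : bool -> seq bool) (tail : seq bool).
Hypothesis tail_neq0 : tail != [::].

Local Notation cell := (tm_cell M).

(** A tape letter is a cell of M, or a bit of the first copy of w; the latter stays
distinguishable from a cell until M overwrites it, so that the copying phase finds the
border between the two copies. *)
Definition tape : finType := (bool + option (bool + tm_aux M))%type.
Definition tape_val (x : tape) : cell :=
  match x with inl b => Some (inl b) | inr c => c end.

(** A bit still to be copied, a tape letter, or an end marker. *)
Definition sym : finType := (bool + tape + bool)%type.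
Definition source (b : bool) : sym := inl (inl b).
Definition on_tape (x : tape) : sym := inl (inr x).
Definition lend : sym := inr false.
Definition rend : sym := inr true.

Definition copied (w : seq bool) : seq tape := [seq inl b | b <- w].
Definition bits (w : seq bool) : seq tape := [seq inr (Some (inl b)) | b <- w].

(** The heads of the copying phase: one starts it, one fetches the next bit from the
left, and one carries the bit b to the right. Then come the states of M. *)
Definition control : finType := (option (option bool) + tm_state M)%type.
Definition h_start : control := inl None.
Definition h_fetch : control := inl (Some None).
Definition h_carry (b : bool) : control := inl (Some (Some b)).
Definition h_state (q : tm_state M) : control := inr q.

Local Notation verdict := (verdict sym control).
Local Notation stop := (Stop sym control).
Local Notation kill := (Kill sym control).

(** Having no more bits to fetch, the head turns into the start state of M. *)
Definition delta_fetch (a c : sym) : verdict :=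
  match a with
  | inl (inl b) => Go [:: on_tape (inl b)] (h_carry b) [:: c]
  | inl (inr x) => Go [::] h_fetch [:: on_tape x; c]
  | inr _ => Go [:: a] (h_state (tm_start M)) [:: c]
  end.

(** The carried bit passes the first copy, and its code is dropped in front of the
second one. *)
Definition delta_carry (b : bool) (a c : sym) : verdict :=
  match c with
  | inl (inr (inl b')) => Go [:: a; c] (h_carry b) [::]
  | inl (inr (inr _)) =>
      Go [:: a] h_fetch (rcons [seq on_tape x | x <- bits (code b)] c)
  | _ => stop
  end.

(** The steps of M; blanks are created at the end markers as needed. *)
Definition delta_state (q : tm_state M) (a c : sym) : verdict :=
  let act (s : cell) (rest : seq sym) :=
    match tm_trans q s with
    | None => if tm_accepting q then stop else kill
    | Some (q', s', dir) =>
        let c' := on_tape (inr s') in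
        match dir with
        | MoveLeft =>
            if a is inl _ then Go [::] (h_state q') [:: a, c' & rest]
            else Go [:: a] (h_state q') [:: on_tape (inr None), c' & rest]
        | Stay => Go [:: a] (h_state q') (c' :: rest)
        | MoveRight => Go [:: a; c'] (h_state q') rest
        end
    end in
  match c with
  | inl (inr x) => act (tape_val x) [::]
  | inr true => act None [:: rend]
  | _ => stop
  end.

Definition delta (a : sym) (h : control) (c : sym) : verdict :=
  match h with
  | inl None => Go [:: a] h_fetch (rcons [seq on_tape x | x <- bits tail] c)
  | inl (Some None) => delta_fetch a c
  | inl (Some (Some b)) => delta_carry b a c
  | inr q => delta_state q a c
  end.

Local Notation step := (step delta).
Local Notation steps := (steps delta).

(** The bits w still to be copied, then the tape, with l read from the head
leftwards. *)
Definition conf (w : seq bool) (l : seq tape) (h : control) (r : seq tape) :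
    seq (sym + control) :=
  cfg (lend :: [seq source b | b <- w] ++ [seq on_tape x | x <- rev l]) h
      (rcons [seq on_tape x | x <- r] rend).

Definition start_word (w : seq bool) : seq (sym + control) :=
  cfg (lend :: [seq source b | b <- w]) h_start [:: rend].

Lemma steps1 g g' : step g g' -> steps g g'.
Proof. by move=> st; apply: steps_step st (steps_refl _ _). Qed.

Definition hd_right (r : seq tape) : sym := if r is x :: _ then on_tape x else rend.
Definition tl_right (r : seq tape) : seq sym :=
  if r is _ :: r' then rcons [seq on_tape x | x <- r'] rend else [::].

Lemma rightE r : rcons [seq on_tape x | x <- r] rend = hd_right r :: tl_right r.
Proof. by case: r. Qed.

Definition hd_left (w : seq bool) (l : seq tape) : sym :=
  if l is x :: _ then on_tape x else last lend [seq source b | b <- w].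
Definition tl_left (w : seq bool) (l : seq tape) : seq sym :=
  if l is _ :: l' then lend :: [seq source b | b <- w] ++ [seq on_tape x | x <- rev l']
  else belast lend [seq source b | b <- w].

Lemma leftE w l : lend :: [seq source b | b <- w] ++ [seq on_tape x | x <- rev l] =
  rcons (tl_left w l) (hd_left w l).
Proof.
case: l => [|x l] /=; first by rewrite cats0 -lastI.
by rewrite rev_cons map_rcons -rcons_cat.
Qed.

Lemma confE w l h r :
  conf w l h r = cfg (rcons (tl_left w l) (hd_left w l)) h (hd_right r :: tl_right r).
Proof. by rewrite /conf leftE rightE. Qed.

Lemma conf_step w l h r vl h' vr : delta (hd_left w l) h (hd_right r) = Go vl h' vr ->
  step (conf w l h r) (cfg (tl_left w l ++ vl) h' (vr ++ tl_right r)).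
Proof. by rewrite confE; apply: step_cfg. Qed.

Lemma start_step w :
  step (start_word w) (conf w [::] h_fetch (bits tail)).
Proof.
have -> : start_word w = conf w [::] h_start [::] by rewrite /start_word /conf /= cats0.
have := @conf_step w [::] h_start [::] _ _ _ erefl.
by rewrite /conf cats1 /= -lastI !cats0.
Qed.

Lemma fetch_left w l r : steps (conf w l h_fetch r) (conf w [::] h_fetch (rev l ++ r)).
Proof.
elim: l r => [|x l IH] r; first exact: steps_refl.
rewrite rev_cons cat_rcons; apply: steps_step (IH (x :: r)).
have := @conf_step w (x :: l) h_fetch r _ _ _ erefl.
by rewrite /conf /= cats0 -rightE.
Qed.

Lemma fetch_source w b r :
  step (conf (rcons w b) [::] h_fetch r) (conf w [:: inl b] (h_carry b) r).
Proof.
have := @conf_step (rcons w b) [::] h_fetch r [:: on_tape (inl b)] (h_carry b)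
  [:: hd_right r].
rewrite /= map_rcons last_rcons => /(_ erefl).
by rewrite /conf -rightE /= belast_rcons -cats1.
Qed.

Lemma left_keep w l : tl_left w l ++ [:: hd_left w l] =
  lend :: [seq source b | b <- w] ++ [seq on_tape x | x <- rev l].
Proof. by rewrite cats1 leftE. Qed.

Lemma left_push w l x : tl_left w l ++ [:: hd_left w l; on_tape x] =
  lend :: [seq source b | b <- w] ++ [seq on_tape x | x <- rev (x :: l)].
Proof.
by rewrite -cat_rcons -leftE rev_cons map_rcons -cats1 /= -catA.
Qed.

Lemma carry_right w l b u r :
  steps (conf w l (h_carry b) (copied u ++ r))
        (conf w (rev (copied u) ++ l) (h_carry b) r).
Proof.
elim: u l => [|b' u IH] l; first exact: steps_refl.
rewrite [copied _]/= rev_cons cat_rcons; apply: steps_step (IH (inl b' :: l)).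
have := @conf_step w l (h_carry b) (copied (b' :: u) ++ r) _ _ _ erefl.
by rewrite left_push.
Qed.

Lemma carry_drop w l b s r :
  step (conf w l (h_carry b) (inr s :: r))
       (conf w l h_fetch (bits (code b) ++ inr s :: r)).
Proof.
have := @conf_step w l (h_carry b) (inr s :: r) _ _ _ erefl.
by rewrite left_keep /conf map_cat rcons_cat cat_rcons.
Qed.

(** Bits are copied from the last one to the first: each is put in front of the first
copy, and its code in front of the second. The head needs a cell at which to
stop, whence the nonempty v. *)
Lemma copy_bit w b u v : v != [::] ->
  steps (conf (rcons w b) [::] h_fetch (copied u ++ bits v))
        (conf w [::] h_fetch (copied (b :: u) ++ bits (code b ++ v))).
Proof.
case: v => // s v _; apply: steps_step (fetch_source _ _ _) _.
apply: steps_trans (carry_right _ _ _ _ _) _.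
apply: steps_step (carry_drop _ _ _ _ _) _.
have := fetch_left w (rev (copied u) ++ [:: inl b]) (bits (code b) ++ bits (s :: v)).
by rewrite rev_cat revK /bits -map_cat.
Qed.

(** u and v are the parts of the two copies that are already there. *)
Lemma copy_word w u v : v != [::] ->
  steps (conf w [::] h_fetch (copied u ++ bits v))
        (conf [::] [::] h_fetch
          (copied (w ++ u) ++ bits (flatten [seq code b | b <- w] ++ v))).
Proof.
elim/last_ind: w u v => [|w b IH] u v v0; first exact: steps_refl.
apply: steps_trans (copy_bit _ _ _ v0) _.
have := IH (b :: u) (code b ++ v).
rewrite cat_rcons map_rcons -cats1 flatten_cat /= cats0 -catA; apply.
by case: (code b).
Qed.

Lemma fetch_end r :
  step (conf [::] [::] h_fetch r) (conf [::] [::] (h_state (tm_start M)) r).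
Proof.
have := @conf_step [::] [::] h_fetch r _ _ _ erefl.
by rewrite left_keep [_ ++ tl_right r]/= -rightE.
Qed.

Lemma start_word_steps w :
  steps (start_word w) (conf [::] [::] (h_state (tm_start M))
    (copied w ++ bits (flatten [seq code b | b <- w] ++ tail))).
Proof.
apply: steps_step (start_step w) _.
apply: steps_trans (copy_word w [::] tail_neq0) _.
by rewrite cats0; apply: steps1; apply: fetch_end.
Qed.

Lemma state_stop q l r :
  tm_step (q, [seq tape_val x | x <- l], [seq tape_val x | x <- r]) = None ->
  delta (hd_left [::] l) (h_state q) (hd_right r) = if tm_accepting q then stop else kill.
Proof.
case: r => [|x r] /=.
  by rewrite /delta_state /=; case: (tm_trans q None) => [[[q' s] dir]|].
by rewrite /delta_state /=; case: (tm_trans q (tape_val x)) => [[[q' s] dir]|].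
Qed.

(** Each step of M is one rewriting step, also at the ends of the tape. *)
Lemma state_step q l r c :
  tm_step (q, [seq tape_val x | x <- l], [seq tape_val x | x <- r]) = Some c ->
  exists q' l' r', c = (q', [seq tape_val x | x <- l'], [seq tape_val x | x <- r']) /\
    step (conf [::] l (h_state q) r) (conf [::] l' (h_state q') r').
Proof.
pose rest := if r is [::] then [:: rend] else [::] : seq sym.
have deltaE : delta (hd_left [::] l) (h_state q) (hd_right r) =
  match tm_trans q (head None [seq tape_val x | x <- r]) with
  | None => if tm_accepting q then stop else kill
  | Some (q', s', dir) =>
      match dir with
      | MoveLeft =>
          if hd_left [::] l is inl _ then
            Go [::] (h_state q') [:: hd_left [::] l, on_tape (inr s') & rest]
          else Go [:: hd_left [::] l] (h_state q')
            [:: on_tape (inr None), on_tape (inr s') & rest]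
      | Stay => Go [:: hd_left [::] l] (h_state q') (on_tape (inr s') :: rest)
      | MoveRight => Go [:: hd_left [::] l; on_tape (inr s')] (h_state q') rest
      end
  end by rewrite /rest; case: (r).
have restE : rest ++ tl_right r = rcons [seq on_tape x | x <- behead r] rend.
  by rewrite /rest; case: (r).
rewrite /tm_step; move: deltaE.
case: (tm_trans q _) => // -[[q' s] dir] deltaE [<-]; move: deltaE.
rewrite !behead_map.
case: dir => deltaE.
- exists q', (behead l), (head (inr None) l :: inr s :: behead r); split.
    by case: (l).
  case: l deltaE => [|x l] deltaE; have := conf_step deltaE.
    by rewrite left_keep !cat_cons restE.
  by rewrite cats0 !cat_cons restE.
- exists q', l, (inr s :: behead r); split=> //.
  by have := conf_step deltaE; rewrite left_keep cat_cons restE.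
- exists q', (inr s :: l), (behead r); split=> //.
  by have := conf_step deltaE; rewrite left_push restE.
Qed.

Lemma tm_ends_steps c f : tm_ends c f -> forall q l r,
  c = (q, [seq tape_val x | x <- l], [seq tape_val x | x <- r]) ->
  exists q' l' r', [/\ f = (q', [seq tape_val x | x <- l'], [seq tape_val x | x <- r']),
    steps (conf [::] l (h_state q) r) (conf [::] l' (h_state q') r')
    & delta (hd_left [::] l') (h_state q') (hd_right r') =
        if tm_accepting q' then stop else kill].
Proof.
elim=> {c f} [c e|c c' f e _ IH] q l r cE; rewrite cE in e *.
  by exists q, l, r; split; [|exact: steps_refl|exact: state_stop].
have [q1 [l1 [r1 [/IH[q' [l' [r' [fE st stop']]]] st1]]]] := state_step e.
by exists q', l', r'; split=> //; apply: steps_step st.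
Qed.

(** If M halts on w ++ h(w) ++ t, then rewriting the start word of w ends at a window
that records the answer of M. *)
Lemma halting_steps w q l r :
  tm_ends (tm_init M (w ++ flatten [seq code b | b <- w] ++ tail)) (q, l, r) ->
  exists l' r' a c, steps (start_word w) (cfg (rcons l' a) (h_state q) (c :: r')) /\
    delta a (h_state q) c = if tm_accepting q then stop else kill.
Proof.
move=> /tm_ends_steps/(_ (tm_start M) [::]
  (copied w ++ bits (flatten [seq code b | b <- w] ++ tail))) [].
  rewrite /tm_init; congr (_, _); rewrite [RHS]map_cat.
  rewrite -[map _ (copied w)]map_comp -[map _ (bits _)]map_comp.
  exact: map_cat.
move=> q' [l' [r' [[-> _ _] st e]]].
exists (tl_left [::] l'), (tl_right r'), (hd_left [::] l'), (hd_right r').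
by split=> //; rewrite -confE; apply: steps_trans (start_word_steps w) st.
Qed.

End Simulation.

(** * The diagonal argument *)
Section EncodingLemmas.
Variables (T : Type) (f : T -> seq bool).

Lemma enc_seq_cat s t :
  enc_seq f (s ++ t) = flatten [seq true :: f x | x <- s] ++ enc_seq f t.
Proof. by rewrite /enc_seq map_cat flatten_cat catA. Qed.

Lemma enc_seq1 x : enc_seq f [:: x] = true :: f x ++ [:: false].
Proof. by rewrite /enc_seq /= cats0. Qed.

Lemma enc_seq2 x y : enc_seq f [:: x; y] = (true :: f x) ++ (true :: f y) ++ [:: false].
Proof. by rewrite /enc_seq /= cats0 -catA. Qed.

Lemma flatten_map2 x y : flatten [seq f z | z <- [:: x; y]] = f x ++ f y.
Proof. by rewrite /= cats0. Qed.

Lemma flatten_map3 x y z : flatten [seq f t | t <- [:: x; y; z]] = f x ++ f y ++ f z.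
Proof. by rewrite /= cats0. Qed.

End EncodingLemmas.

Section Diagonal.
Variables (R : comNzRingType) (M : turing_machine) (w1 wN1 : seq bool).

Local Notation K := (sym M).
Local Notation H := (control M).
Local Notation L := (K + H + bool)%type.
Local Notation J := (option (K * H * K)).

(** The code of one letter inside the code of a word. *)
Definition letter_code (x : L) : seq bool :=
  true :: enc_nat (index x (enum (L : finType))).
Definition bit_code (b : bool) : seq bool := letter_code (inl (inl (source M b))).
(** The letters that follow w in the bracketed start word, and the terminators of the
word, of the polynomial and of the list of generators. *)
Definition tail_code : seq bool :=
  letter_code (inl (inr (h_start M))) ++ letter_code (inl (inl (rend M))) ++
  letter_code (inr true) ++ [:: false; false; false].

Definition machine_rel (w : seq bool) : J -> relation (L : finType) :=
  sys_rel (@delta M bit_code tail_code) (start_word M w).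

(** 1 = 0, for each relator. *)
Definition trivial_rel : J -> relation (L : finType) := fun=> ([::], None).

(** The relation [enclose w0] = 1 comes last, so that the start word is at the end of
the code. *)
Definition relators : seq J :=
  rcons [seq Some j | j <- enum ((K * H * K)%type : finType)] None.

Lemma relators_uniq : uniq relators.
Proof.
rewrite rcons_uniq map_inj_uniq ?enum_uniq ?andbT; last by move=> ? ? [].
by apply/mapP => -[].
Qed.

Lemma relators_all : relators =i (J : finType).
Proof.
by move=> [j|]; rewrite mem_rcons inE //= map_f // mem_enum.
Qed.

Definition code_of (rel : J -> relation (L : finType)) : semifree_code :=
  pres_code rel w1 wN1 (enum (L : finType)) relators.

(** The part of the code before w. The relations other than the last one do not depend
on the start word, which is taken empty here. *)
Definition code_prefix : seq bool :=
  let enc_gen := enc_pair enc_int (enc_seq enc_term) in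
  let gcode := gen_code (machine_rel [::]) w1 wN1 (enum (L : finType)) in
  flatten [seq true :: enc_gen x | x <- [seq gcode (inl a) | a <- enum (L : finType)]] ++
  flatten [seq true :: enc_gen x | x <-
    [seq gcode (inr (Some j)) | j <- enum ((K * H * K)%type : finType)]] ++
  true :: enc_int 1 ++ true :: enc_term (wN1, [::]) ++ true :: enc_word w1 ++
  letter_code (inr false) ++ letter_code (inl (inl (lend M))).

Lemma enc_word_code m : enc_seq enc_nat (word_code (enum (L : finType)) m) =
  flatten [seq letter_code x | x <- m] ++ [:: false].
Proof. by rewrite /enc_seq /word_code -map_comp. Qed.

Lemma enclose_start_word w : enclose (start_word M w) =
  [:: inr false; inl (inl (lend M))] ++
  [seq inl (inl (source M b)) | b <- w] ++
  [:: inl (inr (h_start M)); inl (inl (rend M)); inr true].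
Proof.
rewrite /enclose /start_word /cfg /inner /= map_cat -!map_comp -catA.
by congr [:: _, _ & _ ++ _]; apply: eq_map.
Qed.

Local Notation enc_gen := (enc_pair enc_int (enc_seq enc_term)).
Local Notation gcode w := (gen_code (machine_rel w) w1 wN1 (enum (L : finType))).

Lemma enc_omega w : enc_gen (gcode w (inr None)) =
  (enc_int 1 ++ true :: enc_term (wN1, [::]) ++ true :: enc_word w1 ++
   flatten [seq letter_code x | x <- enclose (start_word M w)]) ++
  [:: false; false].
Proof.
have -> : gcode w (inr None) = (1%R, [:: (wN1, [::]); (w1,
    word_code (enum (L : finType)) (enclose (start_word M w)))]) by [].
move: (enclose (start_word M w)) => m.
have -> : enc_gen (1%R, [:: (wN1, [::]); (w1, word_code (enum (L : finType)) m)]) =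
  enc_int 1 ++ (true :: enc_term (wN1, [::])) ++
  (true :: enc_word w1 ++ enc_seq enc_nat (word_code (enum (L : finType)) m)) ++
  [:: false].
  rewrite /enc_pair [fst _]/= [snd _]/= enc_seq2.
  by [].
by rewrite enc_word_code /= -!catA /= -!catA.
Qed.

Lemma enc_code_of w : enc_semifree (code_of (machine_rel w)) =
  code_prefix ++ flatten [seq bit_code b | b <- w] ++ tail_code.
Proof.
rewrite /enc_semifree /code_of /pres_code /gens /relators map_cat !map_rcons -cats1.
rewrite catA enc_seq_cat map_cat flatten_cat enc_seq1 enc_omega.
rewrite enclose_start_word !map_cat !flatten_cat flatten_map2 flatten_map3.
have -> : flatten [seq letter_code x | x <- [seq inl (inl (source M b)) | b <- w]] =
  flatten [seq bit_code b | b <- w] by rewrite -map_comp.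
have -> : [seq gcode w z | z <- [seq inr j |
    j <- [seq Some j | j <- enum ((K * H * K)%type : finType)]]] =
  [seq gcode [::] (inr (Some j)) | j <- enum ((K * H * K)%type : finType)].
  by rewrite -!map_comp; apply: eq_map.
have -> : [seq gcode w z | z <- [seq inl a | a <- enum (L : finType)]] =
  [seq gcode [::] (inl a) | a <- enum (L : finType)].
  by rewrite -map_comp; apply: eq_map.
rewrite /code_prefix /tail_code.
move: (flatten _) (flatten _) (flatten _) (enc_int 1) (enc_term _) (enc_word w1).
move: (letter_code _) (letter_code _) (letter_code _) (letter_code _) (letter_code _).
by move=> *; rewrite -?catA /= -?catA /= -?catA /= -?catA.
Qed.

(** The code of the first DGA of the pair and the prefix of the code of the second: the
bits that precede h(w) ++ t in the code of the pair. *)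
Definition diagonal_word : seq bool :=
  enc_semifree (code_of trivial_rel) ++ code_prefix.

Lemma enc_diagonal : let w := diagonal_word in
  enc_pair enc_semifree enc_semifree (code_of trivial_rel, code_of (machine_rel w)) =
  w ++ flatten [seq bit_code b | b <- w] ++ tail_code.
Proof.
rewrite /=; have := enc_code_of diagonal_word; rewrite /enc_pair [snd _]/= => ->.
exact: catA.
Qed.

Lemma machine_rejects w q l r :
  tm_ends (tm_init M (w ++ flatten [seq bit_code b | b <- w] ++ tail_code)) (q, l, r) ->
  ~~ tm_accepting q -> boundary (R := R) (machine_rel w) 1%R.
Proof.
move=> /halting_steps[] // l' [r' [a [c [st e]]]] nacc.
by apply: kill_boundary st; rewrite e (negPf nacc).
Qed.

Lemma machine_accepts w q l r :
  tm_ends (tm_init M (w ++ flatten [seq bit_code b | b <- w] ++ tail_code)) (q, l, r) ->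
  tm_accepting q -> ~ one_boundary (presentation R (machine_rel w)).
Proof.
move=> /halting_steps[] // l' [r' [a [c [st e]]]] acc.
by apply: stop_not_one_boundary st; rewrite e acc.
Qed.

Lemma trivial_boundary : boundary (R := R) trivial_rel 1%R.
Proof.
have := @word_boundary_rel R _ _ trivial_rel [::] [::] [::] None erefl.
by rewrite letters_nil.
Qed.

End Diagonal.

Section Undecidable.
Variables (R : comNzRingType) (rep : seq bool -> R -> Prop).
Variable problem : semifree R -> semifree R -> Prop.
Hypothesis problem_of_boundary : forall (L J : finType) (rel rel' : J -> relation L),
  boundary (R := R) rel 1%R -> boundary (R := R) rel' 1%R ->
  problem (presentation R rel) (presentation R rel').
Hypothesis boundary_of_problem : forall (L J : finType) (rel rel' : J -> relation L),
  problem (presentation R rel) (presentation R rel') ->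
  boundary (R := R) rel 1%R -> one_boundary (presentation R rel').

(** The machine is asked about the trivial relations and the relations of the system for
the diagonal word. A positive answer stops the system at a stuck word and is refuted by
the functional; a negative one rewrites the start word to 0. *)
Lemma undecidable_of_one_boundary : turing_computable rep -> undecidable rep problem.
Proof.
case=> total _ _ _ _ [M decM].
have [[w1 rep1] [wN1 repN1]] := (total 1%R, total (-1)%R).
pose w := diagonal_word M w1 wN1; pose rel := @machine_rel M w.
have codes rel' : semifree_codes rep (@code_of M w1 wN1 rel') (presentation R rel').
  apply: pres_codesP => //; first exact: enum_uniq.
  - by move=> x; rewrite mem_enum.
  - exact: relators_uniq.
  - exact: relators_all.
have [] := decM _ _ _ _ (codes (@trivial_rel M)) (codes rel).
rewrite enc_diagonal => acc rej.
have triv := trivial_boundary R M.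
have not_problem : ~ problem (presentation R (@trivial_rel M)) (presentation R rel).
  move=> pb; have [q [l [r [halt acq]]]] := acc pb.
  exact: machine_accepts halt acq (boundary_of_problem pb triv).
have [q [l [r [halt req]]]] := rej not_problem.
apply: not_problem; apply: problem_of_boundary triv _.
exact: machine_rejects halt req.
Qed.

End Undecidable.

Theorem theorem1 (R : comNzRingType) (rep : seq bool -> R -> Prop)
    (computable_R : turing_computable rep) :
  [/\ undecidable rep (fun A B : semifree R => stable_tame_isomorphic A B),
      undecidable rep (fun A B : semifree R =>
        quasi_isomorphic (dga_of_semifree A) (dga_of_semifree B))
    & undecidable rep (fun A B : semifree R =>
        derived_Morita_equivalent (dga_of_semifree A) (dga_of_semifree B))].
Proof.
have dga_boundary (L J : finType) (rel : J -> relation L) :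
    boundary (R := R) rel 1%R ->
    dga_one_boundary (dga_of_semifree (presentation R rel)).
  by case=> u uh du; exact: (@semifree_dga_one_boundary R (presentation R rel) u uh du).
split; apply: (undecidable_of_one_boundary _ _ computable_R) => L J rel rel'.
- exact: presentation_stable_tame.
- by move=> st [u _ du]; apply: stable_tame_one_boundary st _; exists u.
- by move=> b b'; apply: quasi_isomorphic_of_one_boundary; apply: dga_boundary.
- move=> qi b; apply: dga_semifree_one_boundary.
  exact: quasi_isomorphic_one_boundary qi (dga_boundary _ _ _ b).
- by move=> b b'; apply: derived_Morita_of_one_boundary; apply: dga_boundary.
- move=> dm b; apply: dga_semifree_one_boundary.
  exact: derived_Morita_one_boundary dm (dga_boundary _ _ _ b).
Qed.
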